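(* There is an algorithm that, given a finite tree $T=(V,E)$ with a positive length function $\ell$ on $E$, computes an optimal allocation for $T$, i.e., a pair $({\mathcal B}^*,r^* )$ where ${\mathcal B}^*$ is a valid budget allocation and $r^*\in V$ with $\operatorname{wr}_{{\mathcal B}^*}(r^* )=\operatorname{BR}(T)$, in time linear in the size of $T$ (counting arithmetic operations, including square roots, as unit cost).
   Context: A valid budget allocation is ${\mathcal B}:E\to\mathbb{R}_{\ge 0}$ with $\sum_{e\in E}{\mathcal B}(e)=1$. The weight of an edge is $\omega_{{\mathcal B}}(e)=\ell(e)/{\mathcal B}(e)$ ($+\infty$ if ${\mathcal B}(e)=0$); $\delta_{{\mathcal B}}(u,v)$ is the minimum total weight of a simple path from $u$ to $v$; $\operatorname{wr}_{{\mathcal B}}(r)=\max_{v\in V}\delta_{{\mathcal B}}(r,v)$. $\operatorname{BR}(T,r)=\min_{{\mathcal B}}\operatorname{wr}_{{\mathcal B}}(r)$ over valid allocations, and $\operatorname{BR}(T)=\min_{v\in V}\operatorname{BR}(T,v)$. *)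

(* Defs.v *)
From HB Require Import structures.
From mathcomp Require Import all_boot all_order all_algebra.
From mathcomp Require Import boolp classical_sets reals constructive_ereal ereal.

Set Implicit Arguments.
Unset Strict Implicit.
Unset Printing Implicit Defensive.

Import Order.TTheory GRing.Theory Num.Theory.
Local Open Scope classical_set_scope.
Local Open Scope ring_scope.

(** * Trees and budget allocations *)

(* An edge is an unordered pair of vertices, i.e. a two-element {set V}. *)
Definition adj (V : finType) (E : {set {set V}}) : rel V :=
  [rel u v | [set u; v]%SET \in E].

Definition is_tree (V : finType) (E : {set {set V}}) : Prop :=
  [/\ (0 < #|V|)%N,
      forall e, e \in E -> #|e| = 2%N,
      forall u v, connect (adj E) u v
    & (* [ucycle] also accepts the back-and-forth walk u, v along one edge *)
      forall c : seq V, ucycle (adj E) c -> (size c <= 2)%N].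

Section Budget.
Variables (R : realType) (V : finType) (E : {set {set V}}).
Variable ell : {set V} -> R.

(* Lengths and budgets are functions on E; the values taken outside of E are
   never looked at. *)
Definition valid_allocation (B : {set V} -> R) : Prop :=
  (forall e, e \in E -> 0 <= B e) /\ \sum_(e in E) B e = 1.

Definition omega (B : {set V} -> R) (e : {set V}) : \bar R :=
  if B e == 0 then +oo%E else (ell e / B e)%:E.

(* u :: p is the sequence of vertices of the path; p = [::] is the trivial
   path from u to u. *)
Definition simple_path (u v : V) (p : seq V) : bool :=
  [&& path (adj E) u p, uniq (u :: p) & last u p == v].

Definition path_weight (B : {set V} -> R) (u : V) (p : seq V) : \bar R :=
  (\sum_(w <- pairmap (fun x y => omega B [set x; y]%SET) u p) w)%E.

(* The infimum is over finitely many paths, hence a minimum. *)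
Definition delta (B : {set V} -> R) (u v : V) : \bar R :=
  ereal_inf [set path_weight B u p | p in [set p | simple_path u v p]].

Definition wr (B : {set V} -> R) (r : V) : \bar R :=
  \big[maxe/-oo%E]_(v : V) delta B r v.

(* BR(T, r), as an infimum: it is a minimum exactly when some valid B satisfies
   wr B r = BRr r.  There is no valid allocation if E is empty. *)
Definition BRr (r : V) : \bar R :=
  ereal_inf [set wr B r | B in valid_allocation].

Definition BR : \bar R := \big[mine/+oo%E]_(v : V) BRr v.

End Budget.

(** * A unit-cost real RAM

   Programs are written in a structured imperative language over two sorts of
   data, reals and natural numbers (indices), each with scalar variables and
   arrays, all named by natural numbers.  Indices only support addition,
   truncated subtraction and comparison; reals only support the field
   operations, square root and comparison.  The only real literals are the
   natural numbers, and no operation turns a real into an index (in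
   particular there is no floor function). *)

Inductive iexp : Type :=
| IConst of nat
| IVar of nat
| IGet of nat & iexp (* IGet a i: cell i of the index array a *)
| IAdd of iexp & iexp
| ISub of iexp & iexp.

Inductive rexp : Type :=
| RConst of nat
| RVar of nat
| RGet of nat & iexp (* RGet a i: cell i of the real array a *)
| RAdd of rexp & rexp
| RSub of rexp & rexp
| RMul of rexp & rexp
| RDiv of rexp & rexp
| RSqrt of rexp.

Inductive bexp : Type :=
| BIEq of iexp & iexp
| BILt of iexp & iexp
| BREq of rexp & rexp
| BRLt of rexp & rexp
| BNot of bexp
| BAnd of bexp & bexp.

Inductive cmd : Type :=
| CSkip
| CISet of nat & iexp
| CIPut of nat & iexp & iexp (* CIPut a i e: cell i of index array a := e *)
| CRSet of nat & rexp
| CRPut of nat & iexp & rexp (* CRPut a i e: cell i of real array a := e *)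
| CSeq of cmd & cmd
| CIf of bexp & cmd & cmd
| CWhile of bexp & cmd.

(* Every node of an expression is one operation. *)
Fixpoint icost (e : iexp) : nat :=
  (match e with
  | IConst _ | IVar _ => 1
  | IGet _ i => (icost i).+1
  | IAdd e1 e2 | ISub e1 e2 => (icost e1 + icost e2).+1
  end)%N.

Fixpoint rcost (e : rexp) : nat :=
  (match e with
  | RConst _ | RVar _ => 1
  | RGet _ i => (icost i).+1
  | RAdd e1 e2 | RSub e1 e2 | RMul e1 e2 | RDiv e1 e2 =>
      (rcost e1 + rcost e2).+1
  | RSqrt e1 => (rcost e1).+1
  end)%N.

Fixpoint bcost (b : bexp) : nat :=
  (match b with
  | BIEq e1 e2 | BILt e1 e2 => (icost e1 + icost e2).+1
  | BREq e1 e2 | BRLt e1 e2 => (rcost e1 + rcost e2).+1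
  | BNot b1 => (bcost b1).+1
  | BAnd b1 b2 => (bcost b1 + bcost b2).+1
  end)%N.

Record state (R : Type) : Type := State {
  ivar : nat -> nat;
  iarr : nat -> nat -> nat;
  rvar : nat -> R;
  rarr : nat -> nat -> R
}.

Section Semantics.
Variable R : realType.
Implicit Types s : state R.

Definition upd (T : Type) (f : nat -> T) (i : nat) (x : T) : nat -> T :=
  [eta f with i |-> x].

Definition set_ivar s x k := State (upd (ivar s) x k) (iarr s) (rvar s) (rarr s).
Definition set_iarr s a i k :=
  State (ivar s) (upd (iarr s) a (upd (iarr s a) i k)) (rvar s) (rarr s).
Definition set_rvar s x z := State (ivar s) (iarr s) (upd (rvar s) x z) (rarr s).
Definition set_rarr s a i z :=
  State (ivar s) (iarr s) (rvar s) (upd (rarr s) a (upd (rarr s a) i z)).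

Fixpoint ieval s (e : iexp) : nat :=
  match e with
  | IConst k => k
  | IVar x => ivar s x
  | IGet a i => iarr s a (ieval s i)
  | IAdd e1 e2 => (ieval s e1 + ieval s e2)%N
  | ISub e1 e2 => (ieval s e1 - ieval s e2)%N
  end.

(* Operations are total: x / 0 = 0, and the square root of a negative number
   is 0. *)
Fixpoint reval s (e : rexp) : R :=
  match e with
  | RConst k => k%:R
  | RVar x => rvar s x
  | RGet a i => rarr s a (ieval s i)
  | RAdd e1 e2 => reval s e1 + reval s e2
  | RSub e1 e2 => reval s e1 - reval s e2
  | RMul e1 e2 => reval s e1 * reval s e2
  | RDiv e1 e2 => reval s e1 / reval s e2
  | RSqrt e1 => Num.sqrt (reval s e1)
  end.

Fixpoint beval s (b : bexp) : bool :=
  match b with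
  | BIEq e1 e2 => ieval s e1 == ieval s e2
  | BILt e1 e2 => (ieval s e1 < ieval s e2)%N
  | BREq e1 e2 => reval s e1 == reval s e2
  | BRLt e1 e2 => reval s e1 < reval s e2
  | BNot b1 => ~~ beval s b1
  | BAnd b1 b2 => beval s b1 && beval s b2
  end.

(* exec c s t s': started in s, the command c halts in s' after exactly t
   operations. *)
Inductive exec : cmd -> state R -> nat -> state R -> Prop :=
| exec_skip s : exec CSkip s 1 s
| exec_iset s x e :
    exec (CISet x e) s (icost e).+1 (set_ivar s x (ieval s e))
| exec_iput s a i e :
    exec (CIPut a i e) s (icost i + icost e).+1
      (set_iarr s a (ieval s i) (ieval s e))
| exec_rset s x e :
    exec (CRSet x e) s (rcost e).+1 (set_rvar s x (reval s e))
| exec_rput s a i e :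
    exec (CRPut a i e) s (icost i + rcost e).+1
      (set_rarr s a (ieval s i) (reval s e))
| exec_seq c1 c2 s s1 s2 t1 t2 :
    exec c1 s t1 s1 -> exec c2 s1 t2 s2 -> exec (CSeq c1 c2) s (t1 + t2) s2
| exec_if b c1 c2 s s1 t :
    exec (if beval s b then c1 else c2) s t s1 ->
    exec (CIf b c1 c2) s (bcost b + t) s1
| exec_while_false b c s :
    ~~ beval s b -> exec (CWhile b c) s (bcost b) s
| exec_while_true b c s s1 s2 t1 t2 :
    beval s b -> exec c s t1 s1 -> exec (CWhile b c) s1 t2 s2 ->
    exec (CWhile b c) s (bcost b + t1 + t2) s2.

End Semantics.

(** * Input and output conventions

   A tree is given by a list vs of its vertices and a list es of its edges, in
   arbitrary order and with each edge written in either orientation; a vertex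
   is known to the machine by its position in vs, an edge by its position in
   es. *)

Section InputOutput.
Variables (R : realType) (V : finType).

Definition edge_of (p : V * V) : {set V} := [set p.1; p.2]%SET.

Definition lists_graph (E : {set {set V}}) (vs : seq V) (es : seq (V * V)) :=
  perm_eq vs (enum V) && perm_eq (map edge_of es) (enum E).

Definition input_state (ell : {set V} -> R) (vs : seq V) (es : seq (V * V)) :
    state R :=
  {| ivar := nth 0%N [:: size vs; size es];
     iarr := nth (fun=> 0%N)
       [:: nth 0%N [seq index p.1 vs | p <- es];
           nth 0%N [seq index p.2 vs | p <- es]];
     rvar := fun=> 0;
     rarr := nth (fun=> 0) [:: nth 0 [seq ell (edge_of p) | p <- es]] |}.

(* The root is returned in index variable 0, the budgets in real array 0. *)
Definition output_is (s : state R) (vs : seq V) (es : seq (V * V))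
    (B : {set V} -> R) (r : V) : Prop :=
  ivar s 0%N = index r vs /\
  mkseq (rarr s 0%N) (size es) = [seq B (edge_of p) | p <- es].

End InputOutput.

(* Main.v *)
(* Let D(v) be the optimum for the subtree hanging at v, with unit budget.  A
   budget split among the branches at v is best when all branches get equal
   radius, so the optima of the branches add up; a branch made of an edge of
   length l and a subtree of value d has optimum (sqrt l + sqrt d)^2, by
   Cauchy-Schwarz.  Hence D(v) is the sum of (sqrt l + sqrt D(c))^2 over the
   children c of v, and the equality case gives the budgets from the root
   downwards.  Moving the root along an edge changes only the two values at its
   ends, so one more pass yields the values for all roots.  Each pass is linear
   once the vertices are ordered by stripping leaves. *)

Require Import Defs.
From mathcomp Require Import all_boot all_order all_algebra.
From mathcomp Require Import boolp classical_sets reals constructive_ereal ereal.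
From mathcomp Require Import ring lra zify.

Set Implicit Arguments.
Unset Strict Implicit.
Unset Printing Implicit Defensive.

Import Order.TTheory GRing.Theory Num.Theory.
Local Open Scope ring_scope.


(** * Rooted trees *)

(** The lower bound never restricts an allocation to a subtree and rescales it. For one fixed
    allocation of finite radius [M], let [d v] be the distance from the root to [v] and [b v] the
    budget spent below [v]. Then [D v <= (M - d v) * b v] holds from the leaves upwards, at the
    price of one Cauchy-Schwarz inequality per edge, and at the root [b r = 1] gives [D r <= M].

    Moving the root from [p] to a neighbour [c] works because the branch of [c] can be subtracted
    from the value at [p]: the rest is the value of the other side of the edge, which becomes a new
    branch at [c]. The obstacle is that every root comes with its own parent function, chosen
    independently of the others. Values are compared through one principle: a vertex that is no root
    and has the same parent in two rootings has the same subtree below it in both. *)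

Record rooting (V : finType) (E : {set {set V}}) (r : V) (par : V -> V)
    (h : V -> nat) : Prop := Rooting {
  par_edge : forall v, v != r -> [set v; par v] \in E;
  par_lt : forall v, v != r -> (h (par v) < h v)%N;
  edge_par : forall u v, [set u; v] \in E ->
    (u != r) && (par u == v) || (v != r) && (par v == u)
}.

Section Rooting.
Variables (V : finType) (E : {set {set V}}).

(* Otherwise the path and the edge [u v] form a cycle. *)
Lemma tree_bridge (u v : V) (e : rel V) : is_tree E -> u != v ->
  [set u; v] \in E ->
  (forall x y, e x y -> adj E x y && ([set x; y] != [set u; v])) ->
  ~~ connect e u v.
Proof.
move=> [_ _ _ acyc] uv uvE sub; apply/negP => /connectP[p0 p0P v0].
case: (shortenP p0P) v0 => p pP pU _ lp {p0 p0P}.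
have := acyc (u :: p); rewrite /ucycle /= rcons_path -lp.
have -> : adj E v u by rewrite /adj /= finset.setUC.
have /= -> := pU; rewrite !andbT (sub_path _ pP); last by move=> x y /sub /andP[].
move=> /(_ isT); case: p pP pU lp => [|x [|y p]] //=.
  by move=> _ _ vu; rewrite vu eqxx in uv.
by rewrite andbT => /sub/andP[_ +] _ xv; rewrite xv eqxx.
Qed.

Lemma tree_rooting (r : V) : is_tree E ->
  exists par h, rooting E r par h.
Proof.
move=> T; have [_ _ conn _] := T.
pose P v k := [exists p : k.-tuple V, path (adj E) r p && (last r p == v)].
have exP v : exists k, P v k.
  have /connectP[p pP lp] := conn r v; exists (size p); apply/existsP.
  by exists (in_tuple p); rewrite /= pP lp eqxx.
pose h v := ex_minn (exP v).
have hP v : P v (h v) by rewrite /h; case: ex_minnP.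
have hmin v k : P v k -> (h v <= k)%N by rewrite /h; case: ex_minnP => m _; apply.
have step v : v != r -> exists u, ([set v; u] \in E) && (h u < h v)%N.
  move=> vr; have /existsP[[p /= /eqP sp] /andP[pP /eqP lp]] := hP v.
  case/lastP: p sp pP lp => [|p x]; first by move=> _ _ /= rv; rewrite rv eqxx in vr.
  rewrite last_rcons size_rcons rcons_path => sp /andP[pP ax] xv.
  rewrite {}xv in ax.
  rewrite /adj /= finset.setUC in ax.
  exists (last r p); rewrite ax /= -sp ltnS; apply: hmin.
  by apply/existsP; exists (in_tuple p); rewrite /= pP eqxx.
pose par v := odflt v [pick u | ([set v; u] \in E) && (h u < h v)%N].
have parP v : v != r -> ([set v; par v] \in E) && (h (par v) < h v)%N.
  move=> /step[u uP]; rewrite /par; case: pickP => [//|/(_ u)].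
  by rewrite uP.
exists par, h; split; try by move=> v /parP/andP[].
move=> u v uvE; apply/negPn/negP => /norP[nu nv].
have uv : u != v.
  apply/eqP => uv; have [_ /(_ _ uvE)] := T.
  by rewrite uv finset.setUid cards1.
pose e := [rel x y | adj E x y && ([set x; y] != [set u; v])].
have := @tree_bridge u v e T uv uvE (fun x y xy => xy).
have e_sym : connect_sym e.
  apply: sym_connect_sym => x y.
  by rewrite /e /adj /= (finset.setUC [set x] [set y]).
(* Climbing from parent to parent never uses the edge between [u] and [v], assumed here not to be a
   parent edge. So both ends still reach [r] without it, against [tree_bridge]. *)
have to_r : forall x, connect e x r.
  move=> x; have [n] := ubnP (h x); elim: n x => // n IH x hx.
  have [->|xr] := eqVneq x r; first exact: connect0.
  have /andP[xE hlt] := parP x xr.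
  have cr := IH (par x) (leq_trans hlt hx).
  apply: connect_trans cr; apply: connect1.
  rewrite /e /= /adj /= xE /=; apply/eqP => Eq.
  have xn : x != par x by apply: contraTneq hlt => <-; rewrite ltnn.
  have : x \in [set u; v] by rewrite -Eq !inE eqxx.
  have : par x \in [set u; v] by rewrite -Eq !inE eqxx orbT.
  rewrite !inE => /orP[]/eqP px /orP[]/eqP xx.
  - by rewrite px -xx eqxx in xn.
  - by case/negP: nv; rewrite -xx xr px eqxx.
  - by case/negP: nu; rewrite -xx xr px eqxx.
  - by rewrite px -xx eqxx in xn.
by rewrite (connect_trans (to_r u)) // e_sym.
Qed.

Variables (r : V) (par : V -> V) (h : V -> nat).
Hypothesis rt : rooting E r par h.

Lemma par_neq v : v != r -> par v != v.
Proof. by move=> /(par_lt rt); apply: contraTneq => ->; rewrite ltnn. Qed.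

Lemma rooting_ind_down (P : V -> Prop) :
  P r -> (forall c, c != r -> P (par c) -> P c) -> forall v, P v.
Proof.
move=> Pr IHp v; have [n] := ubnP (h v); elim: n v => // n IH v hn.
have [->//|vr] := eqVneq v r.
by apply: IHp => //; apply: IH; exact: leq_trans (par_lt rt vr) hn.
Qed.

Lemma rooting_ind_up (P : V -> Prop) :
  (forall v, (forall c, c != r -> par c = v -> P c) -> P v) -> forall v, P v.
Proof.
move=> IHc v; have [n] := ubnP (\max_u h u - h v)%N; elim: n v => // n IH v hn.
apply: IHc => c cr cv; apply: IH.
by have := par_lt rt cr; have := @leq_bigmax _ h c; rewrite cv; lia.
Qed.

Lemma rooting_adj v x : [set x; v] \in E =
  (x != r) && (par x == v) || (v != r) && (par v == x).
Proof.
apply/idP/idP; first exact: (edge_par rt).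
case/orP => /andP[nr /eqP <-]; first exact: (par_edge rt).
by rewrite finset.setUC (par_edge rt).
Qed.

Lemma set2_par_inj u v : u != r -> v != r ->
  [set u; par u] = [set v; par v] -> u = v.
Proof.
move=> ur vr Eq.
have : u \in [set v; par v] by rewrite -Eq !inE eqxx.
have : par u \in [set v; par v] by rewrite -Eq !inE eqxx orbT.
rewrite !inE => /orP[]/eqP pu /orP[]/eqP uu //.
  have := par_lt rt ur; have := par_lt rt vr.
  by rewrite pu -uu => /ltnW; rewrite leqNgt => /negbTE ->.
by have := par_lt rt ur; rewrite pu -uu ltnn.
Qed.

Lemma big_edges (T : nmodType) (G : {set V} -> T) :
  (forall e, e \in E -> #|e| = 2%N) ->
  \sum_(e in E) G e = \sum_(c | c != r) G [set c; par c].
Proof.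
move=> E2.
have -> : E = [set [set c; par c] | c in [set~ r]].
  apply/setP => e; apply/idP/imsetP.
    move=> eE; have /eqP/cards2P[u [v [uv e_uv]]] := E2 _ eE.
    rewrite e_uv in eE *.
    case/orP: (edge_par rt eE) => /andP[nr /eqP <-].
      by exists u; rewrite ?inE.
    by exists v; rewrite ?inE // finset.setUC.
  by case=> c; rewrite !inE => cr ->; exact: (par_edge rt).
rewrite big_imset /=; first by apply: eq_bigl => c; rewrite !inE.
by move=> u v; rewrite !inE; exact: set2_par_inj.
Qed.

(** The input writes each edge in an arbitrary orientation; the symmetry of [F] makes that choice
    harmless. *)
Lemma big_edge_list (T : nmodType) (F : V -> V -> T) (es : seq (V * V)) :
  (forall e, e \in E -> #|e| = 2%N) ->
  perm_eq (map (@edge_of V) es) (enum E) ->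
  (forall u v, F u v = F v u) ->
  \sum_(p <- es) F p.1 p.2 = \sum_(c | c != r) F c (par c).
Proof.
move=> E2 perm Fsym.
(* [G] is [F] read off an unordered pair: at an edge exactly one [c] contributes, the lower end. *)
pose G e := \sum_(c | (c != r) && ([set c; par c] == e)) F c (par c).
have Gpar c : c != r -> G [set c; par c] = F c (par c).
  move=> cr; rewrite /G (bigD1 c) /=; last by rewrite cr eqxx.
  rewrite big1 ?addr0 // => d /andP[/andP[dr /eqP /(set2_par_inj dr cr) ->]].
  by rewrite eqxx.
transitivity (\sum_(p <- es) G (edge_of p)).
  apply: eq_big_seq => -[u v] uv /=.
  have : edge_of (u, v) \in E.
    by rewrite -mem_enum -(perm_mem perm) map_f.
  rewrite /edge_of /= => /(edge_par rt)/orP[]/andP[nr /eqP<-]; rewrite -?Gpar //.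
  by rewrite finset.setUC -?Gpar // Gpar.
rewrite -(big_map (@edge_of V) xpredT G) (perm_big _ perm) /= big_enum /=.
by rewrite big_edges //; apply: eq_bigr => c /Gpar.
Qed.

(** Recursion over children by bounded unfolding: [k] unfoldings are enough once [k + h v] exceeds
    the maximal height, since heights grow along every chain of descendants. *)
Lemma tree_rec (T : nmodType) (f : V -> T -> T) :
  exists g : V -> T, forall v, g v = \sum_(c | (c != r) && (par c == v)) f c (g c).
Proof.
pose D := fix D k v : T := if k is k'.+1 then
  \sum_(c | (c != r) && (par c == v)) f c (D k' c) else 0.
pose H := \max_v h v.
have stab k : forall v, (H < k + h v)%N -> D k v = D k.+1 v.
  elim: k => [|k IH] v Hk.
    by have := @leq_bigmax _ h v; rewrite leqNgt; rewrite -/H => /negP.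
  apply: eq_bigr => c /andP[cr /eqP cv]; congr (f c _); apply: IH.
  by apply: (leq_trans Hk); rewrite addSnnS leq_add2l -cv (par_lt rt).
exists (D H.+1) => v; apply: eq_bigr => c /andP[cr _].
congr (f c _); apply: stab; rewrite -[X in (X < _)%N]addn0 ltn_add2l.
exact: leq_ltn_trans (par_lt rt cr).
Qed.

(** Summing the hypothesis over all [v] counts every non-root vertex once, under its parent; the
    values of [f] away from the root then cancel. *)
Lemma telescope_tree (T : zmodType) (f B : V -> T) :
  (forall v, f v = \sum_(c | (c != r) && (par c == v)) (B c + f c)) ->
  f r = \sum_(c | c != r) B c.
Proof.
move=> fE; apply: (@addIr _ (\sum_(c | c != r) f c)).
rewrite -big_split /= [RHS](partition_big par predT) //=.
transitivity (\sum_v f v); first by rewrite [RHS](bigD1 r).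
by apply: eq_bigr => v _; exact: fE.
Qed.

End Rooting.


(** * Subtree values and their change under rerooting *)

Section Value.
Variables (R : realType) (V : finType) (E : {set {set V}}).
Variable ell : {set V} -> R.
Hypothesis E2 : forall e, e \in E -> #|e| = 2%N.
Hypothesis ell_gt0 : forall e, e \in E -> 0 < ell e.

Definition branch (l d : R) := (Num.sqrt l + Num.sqrt d) ^+ 2.

Definition tree_value (r : V) (par : V -> V) (D : V -> R) :=
  forall v, D v =
    \sum_(c | (c != r) && (par c == v)) branch (ell [set c; par c]) (D c).

Lemma tree_value_ge0 r par D v : tree_value r par D -> 0 <= D v.
Proof. by move=> ->; apply: sumr_ge0 => c _; exact: sqr_ge0. Qed.

Lemma branch_gt0 l d : 0 < l -> 0 < branch l d.
Proof.
by move=> l0; rewrite exprn_gt0 // ltr_wpDr ?sqrtr_ge0 // sqrtr_gt0.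
Qed.

Lemma tree_value_gt0 r par h D c : rooting E r par h -> tree_value r par D ->
  c != r -> 0 < D (par c).
Proof.
move=> rt DE cr; rewrite DE (bigD1 c) ?cr ?eqxx //=.
apply: ltr_wpDr; first by apply: sumr_ge0 => x _; exact: sqr_ge0.
by apply/branch_gt0/ell_gt0/(par_edge rt).
Qed.

Section Reroot.
Variables (r r' : V) (par par' : V -> V) (h h' : V -> nat) (D D' : V -> R).
Hypotheses (rt : rooting E r par h) (rt' : rooting E r' par' h').
Hypotheses (DE : tree_value r par D) (DE' : tree_value r' par' D').

(** The neighbours of [v] do not depend on the rooting, and all of them but the parent are
    children. *)
Lemma same_children v c : v != r -> v != r' -> par v = par' v ->
  (c != r) && (par c == v) = (c != r') && (par' c == v).
Proof.
move=> vr vr' pp; apply/idP/idP => /andP[cr /eqP cv].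
- have := par_edge rt cr; rewrite cv => /(edge_par rt')/orP[]// /andP[_ /eqP pv].
  have := par_lt rt cr; have := par_lt rt vr.
  by rewrite pp pv cv => /ltnW; rewrite leqNgt => /negbTE ->.
- have := par_edge rt' cr; rewrite cv => /(edge_par rt)/orP[]// /andP[_ /eqP pv].
  have := par_lt rt' cr; have := par_lt rt' vr'.
  by rewrite -pp pv cv => /ltnW; rewrite leqNgt => /negbTE ->.
Qed.

(** Common children again have a common parent, so the agreement spreads to all descendants. *)
Lemma tree_value_agree v : v != r -> v != r' -> par v = par' v -> D v = D' v.
Proof.
elim/(rooting_ind_up rt): v => v IH vr vr' pp.
rewrite DE DE' (eq_bigl (fun c => (c != r') && (par' c == v))); last first.
  by move=> c; exact: same_children.
apply: eq_bigr => c cv'.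
have cv : (c != r) && (par c == v) by rewrite same_children.
have /andP[cr' /eqP pc'] := cv'; have /andP[cr /eqP pc] := cv.
by rewrite pc pc' (IH c) ?pc ?pc'.
Qed.
End Reroot.

(** The edge between [c] and [p] cuts the tree in two. The side of [c] has value [D c] seen from [r]
    or from [p]. The side of [p], as seen from [c], is the tree rooted at [p] without the branch of
    [c], which explains the difference. *)
Lemma reroot r c p h hc hp par parc parp D Dc Dp :
  rooting E r par h -> rooting E c parc hc -> rooting E p parp hp ->
  tree_value r par D -> tree_value c parc Dc -> tree_value p parp Dp ->
  c != r -> par c = p ->
  Dc c = D c + branch (ell [set c; p]) (Dp p - branch (ell [set c; p]) (D c)).
Proof.
move=> rt rtc rtp DE DEc DEp cr pc.
have cpE : [set c; p] \in E by rewrite -pc (par_edge rt).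
have cp : c != p by rewrite eq_sym -pc (par_neq rt).
have pcc : parc p = c.
  by have := cpE; rewrite (rooting_adj rtc) eqxx /= => /andP[_ /eqP].
have ppc : parp c = p.
  by have := cpE; rewrite (rooting_adj rtp) eqxx /= orbF => /andP[_ /eqP].
have e1 : Dp c = D c by apply: (tree_value_agree rtp rt DEp DE); rewrite ?pc.
have -> : Dc c = D c + branch (ell [set c; p]) (Dc p).
  rewrite {1}DEc (bigD1 p) /=; last by rewrite eq_sym cp pcc eqxx.
  rewrite pcc [RHS]addrC finset.setUC; congr (_ + _).
  rewrite {1}DE; apply: eq_big => [x|x /andP[/andP[xc /eqP px] xp]].
    apply/idP/idP => [/andP[/andP[xc /eqP px] xp]|/andP[xr /eqP px]].
      have := par_edge rtc xc; rewrite px => /(edge_par rt)/orP[//|].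
      by rewrite cr pc eq_sym (negbTE xp).
    have xc : x != c by rewrite -px eq_sym (par_neq rt).
    have xp : x != p.
      rewrite -pc; apply: contraTneq (par_lt rt cr) => <-.
      by rewrite -leqNgt -px ltnW // (par_lt rt).
    have := par_edge rt xr; rewrite px => /(edge_par rtc).
    by rewrite eqxx /= orbF xp => /andP[-> ->].
  have pxc : par x = c.
    have := par_edge rtc xc; rewrite px => /(edge_par rt)/orP[/andP[_ /eqP//]|].
    by rewrite cr pc eq_sym (negbTE xp).
  rewrite px pxc; congr (branch _ _).
  apply: (tree_value_agree rtc rt DEc DE); rewrite ?px ?pxc //.
  apply/eqP => xr; have := par_edge rtc xc; rewrite px => /(edge_par rt).
  by rewrite {1}xr eqxx /= cr pc eq_sym (negbTE xp).
suff -> : Dc p = Dp p - branch (ell [set c; p]) (D c) by [].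
apply/(canRL (addrK _)); rewrite [RHS]DEp (bigD1 c) /=; last by rewrite cp ppc eqxx.
rewrite ppc e1 addrC; congr (_ + _).
have ch x : (x != p) && (parp x == p) && (x != c) = (x != c) && (parc x == p).
  apply/idP/idP => /andP[].
    move=> /andP[xp /eqP px] xc; rewrite xc /=.
    have := par_edge rtp xp; rewrite px => /(edge_par rtc); rewrite xc /=.
    by case/orP => [//|/andP[_]]; rewrite pcc eq_sym (negbTE xc).
  move=> xc /eqP px; have xp : x != p by rewrite -px eq_sym (par_neq rtc).
  rewrite xp xc andbT /=.
  have := par_edge rtc xc; rewrite px => /(edge_par rtp); rewrite eqxx orbF.
  by rewrite xp.
rewrite DEc; apply: eq_big => [x|x chx]; first by rewrite ch.
have := chx; rewrite -ch => /andP[/andP[xp /eqP px] _].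
have /andP[xc /eqP px'] := chx.
by rewrite px px' (tree_value_agree rtc rtp DEc DEp) ?px ?px'.
Qed.


(** * Bounds on the weighted radius *)

(** A step upwards would revisit a vertex, because the parent of the current vertex has already been
    passed. [gen] carries this as the parent not lying ahead. *)
Lemma simple_path_par r par h p : rooting E r par h ->
  path (adj E) r p -> uniq (r :: p) ->
  path (fun x y => (y != r) && (par y == x)) r p.
Proof.
move=> rt; suff gen x : (x == r) || (par x \notin p) ->
    path (adj E) x p -> uniq (x :: p) -> path (fun x y => (y != r) && (par y == x)) x p.
  by apply: gen; rewrite eqxx.
elim: p x => //= y p IH x hx /andP[xy yp].
rewrite inE negb_or => /andP[/andP[xy' xp] /andP[yNp up]].
have /andP[yr /eqP py] : (y != r) && (par y == x).
  case/orP: (edge_par rt xy) => [/andP[xr /eqP px]|//].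
  by move: hx; rewrite (negbTE xr) px inE eqxx.
rewrite yr py eqxx /=; apply: IH => //=; last by rewrite yNp.
by rewrite py xp orbT.
Qed.

Lemma path_weight_rcons B r p v : path_weight ell B r (rcons p v) =
  (path_weight ell B r p + omega ell B [set last r p; v])%E.
Proof. by rewrite /path_weight -cats1 pairmap_cat big_cat /= big_seq1. Qed.

Section NonNegative.
Variable B : {set V} -> R.
Hypothesis B_ge0 : forall e, e \in E -> 0 <= B e.

Lemma omega_ge0 e : e \in E -> (0 <= omega ell B e)%E.
Proof.
move=> eE; rewrite /omega; case: ifP => // _.
by rewrite lee_fin divr_ge0 ?B_ge0 // ltW // ell_gt0.
Qed.

Lemma path_weight_ge0 r p : path (adj E) r p -> (0 <= path_weight ell B r p)%E.
Proof.
rewrite /path_weight; elim: p r => [|y p IH] r /=; first by rewrite big_nil.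
by move=> /andP[ry yp]; rewrite big_cons adde_ge0 ?IH // omega_ge0.
Qed.

Lemma delta_ge0 r v : (0 <= delta E ell B r v)%E.
Proof.
apply/ereal_infP => _ [p /= /and3P[pP _ _] <-]; exact: path_weight_ge0.
Qed.

(** A simple path to [v] enters it by its parent edge; without that edge it is a simple path to the
    parent. *)
Lemma delta_par r par h v : rooting E r par h -> v != r ->
  (delta E ell B r (par v) + omega ell B [set v; par v] <= delta E ell B r v)%E.
Proof.
move=> rt vr; apply/ereal_infP => _ [p /= /and3P[pP pU /eqP lp] <-].
have := simple_path_par rt pP pU.
case/lastP: p pP pU lp => [|p x]; first by move=> _ _ /= rv; rewrite -rv eqxx in vr.
rewrite last_rcons !rcons_path => /andP[pP _] pU xv /andP[_ /andP[_ /eqP pv]].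
rewrite {}xv in pU pv *.
rewrite path_weight_rcons -pv (finset.setUC [set v]); apply/leeD2r/ge_ereal_inf.
exists (path_weight ell B r p) => //; exists p => //.
rewrite /= /simple_path pP pv eqxx andbT /=.
by move: pU; rewrite -rcons_cons rcons_uniq => /andP[].
Qed.
End NonNegative.

(** Here [w] and [x] are the weight and the budget of an edge, so that [w * x] is its length; [m] is
    the radius left below the edge and [b] the budget spent there. *)
Lemma branch_le w x m b d : 0 <= w -> 0 <= x -> 0 <= m -> 0 <= b ->
  d <= m * b -> branch (w * x) d <= (w + m) * (x + b).
Proof.
move=> w0 x0 m0 b0 dmb; apply: (@le_trans _ _ (branch (w * x) (m * b))).
  by rewrite ler_sqr ?nnegrE ?addr_ge0 ?sqrtr_ge0 // lerD2l ler_wsqrtr.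
rewrite /branch !sqrtrM //.
rewrite -{2}(sqr_sqrtr w0) -{2}(sqr_sqrtr x0) -{2}(sqr_sqrtr m0) -{2}(sqr_sqrtr b0).
set p := Num.sqrt w; set q := Num.sqrt x; set s := Num.sqrt m; set t := Num.sqrt b.
have := sqr_ge0 (p * t - q * s); lra.
Qed.

Lemma wr_lower_bound r par h D B : rooting E r par h -> tree_value r par D ->
  valid_allocation E B -> ((D r)%:E <= wr E ell B r)%E.
Proof.
move=> rt DE [B0 B1].
have dM v : (delta E ell B r v <= wr E ell B r)%E by exact: le_bigmax.
case: (wr E ell B r) dM => [M| |] dM; last 2 first.
- exact: leey.
- by have := le_trans (delta_ge0 B0 r r) (dM r).
have [b bE] := tree_rec rt (fun c x => B [set c; par c] + x).
have b0 v : 0 <= b v.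
  elim/(rooting_ind_up rt): v => v IH; rewrite bE sumr_ge0 // => c /andP[cr /eqP cv].
  by rewrite addr_ge0 ?IH // B0 // (par_edge rt).
pose d v := fine (delta E ell B r v).
have dK v : (d v)%:E = delta E ell B r v.
  by rewrite fineK // ge0_fin_numE ?delta_ge0 // (le_lt_trans (dM v)) // ltry.
have d0 v : 0 <= d v by rewrite -lee_fin dK delta_ge0.
have dlM v : d v <= M by rewrite -lee_fin dK.
have key v : D v <= (M - d v) * b v.
  elim/(rooting_ind_up rt): v => v IH.
  rewrite DE bE mulr_sumr; apply: ler_sum => c /andP[cr /eqP cv].
  have eE := par_edge rt cr; have := delta_par B rt cr.
  (* An edge without budget has infinite weight, which the finite distance [d c] excludes. *)
  rewrite /omega; case: ifPn => [_|Bn0].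
    by rewrite -!dK addey // leye_eq.
  rewrite cv -!dK -EFinD lee_fin => dc.
  rewrite cv in eE Bn0 *.
  have Bgt0 : 0 < B [set c; v] by rewrite lt_def Bn0 B0.
  rewrite -{1}(divfK Bn0 (ell _)).
  (* The weight of the edge is at most [d c - d v], so the first factor is at most [M - d v]. *)
  apply: (@le_trans _ _ ((ell [set c; v] / B [set c; v] + (M - d c)) * (B [set c; v] + b c))).
    by apply: branch_le; rewrite ?divr_ge0 ?subr_ge0 ?B0 ?b0 ?IH //; exact/ltW/ell_gt0.
  by rewrite ler_wpM2r ?addr_ge0 ?b0 ?B0 //; lra.
rewrite lee_fin; apply: le_trans (key r) _.
have -> : b r = 1.
  rewrite (telescope_tree (B := fun c => B [set c; par c]) bE).
  by rewrite -(big_edges rt) // B1.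
by rewrite mulr1 gerBl.
Qed.

(** * The allocation that attains the value of a root *)

Section Upper.
Variables (r : V) (par : V -> V) (h : V -> nat) (D : V -> R).
Variables (B : {set V} -> R) (b : V -> R).
Hypotheses (rt : rooting E r par h) (DE : tree_value r par D).
Hypothesis (br : b r = 1).
Hypothesis V1 : (1 < #|V|)%N.
(** The branch of [c] receives the fraction [branch (ell [set c; par c]) (D c) / D (par c)] of
    [b (par c)]. Equality in Cauchy-Schwarz divides it between the edge and the subtree in the ratio
    of the two square roots, which cancels one factor of the square. *)
Hypothesis BE : forall c, c != r -> B [set c; par c] =
  b (par c) * (Num.sqrt (ell [set c; par c]) + Num.sqrt (D c)) *
  Num.sqrt (ell [set c; par c]) / D (par c).
Hypothesis bE : forall c, c != r -> b c =
  b (par c) * (Num.sqrt (ell [set c; par c]) + Num.sqrt (D c)) *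
  Num.sqrt (D c) / D (par c).

Let D0 v : 0 <= D v. Proof. exact: tree_value_ge0 DE. Qed.

Let q0 c : c != r -> 0 < Num.sqrt (ell [set c; par c]).
Proof. by move=> cr; rewrite sqrtr_gt0 ell_gt0 // (par_edge rt). Qed.

Let Dr0 : 0 < D r.
Proof.
have [c cr] : exists c, c != r.
  by have /card_gt1P[x [y [_ _ xy]]] := V1; have [xr|] := eqVneq x r;
    [exists y; rewrite -xr eq_sym | exists x].
(* Climbing from [c] ends at a child of [r], and its branch makes [D r] positive. *)
suff : forall v, v = r \/ 0 < D r by case/(_ c) => // cr'; rewrite cr' eqxx in cr.
apply: (rooting_ind_down rt); first by left.
move=> v vr [pr|]; last by right.
by right; rewrite -pr; exact: tree_value_gt0 rt DE vr.
Qed.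

Let b_gt0 v : 0 <= b v /\ (0 < D v -> 0 < b v).
Proof.
elim/(rooting_ind_down rt): v => [|c cr [_ bp]]; first by rewrite br.
have Dp := tree_value_gt0 rt DE cr; have := q0 cr; have := bp Dp.
rewrite (bE cr) => b0 qc; split=> [|Dc].
  by rewrite divr_ge0 ?mulr_ge0 ?addr_ge0 ?sqrtr_ge0 ?D0 // ltW.
have Sc : 0 < Num.sqrt (D c) by rewrite sqrtr_gt0.
by rewrite divr_gt0 ?mulr_gt0 ?addr_gt0.
Qed.

Let b_par c : c != r -> 0 < b (par c).
Proof. by move=> cr; apply: (b_gt0 _).2; exact: tree_value_gt0 rt DE cr. Qed.

Let B_gt0 c : c != r -> 0 < B [set c; par c].
Proof.
move=> cr; rewrite BE // !mulr_gt0 ?b_par ?invr_gt0 ?q0 //.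
  by rewrite ltr_wpDr ?sqrtr_ge0 // q0.
exact: tree_value_gt0 rt DE cr.
Qed.

Lemma budget_valid : valid_allocation E B.
Proof.
split=> [e eE|].
  have /eqP/cards2P[u [v [_ e_uv]]] := E2 eE; rewrite e_uv in eE *.
  case/orP: (edge_par rt eE) => /andP[nr /eqP <-]; first exact/ltW/B_gt0.
  by rewrite finset.setUC; exact/ltW/B_gt0.
rewrite (big_edges rt) // -br; symmetry; apply: (telescope_tree (par := par)) => v.
(* [D v] vanishes only where [v] has no child. There [b v] vanishes too, having [Num.sqrt (D v)] as
   a factor, unless [v] is the root, which [Dr0] rules out. *)
have [Dv|] := boolP (0 < D v); last first.
  rewrite lt_def D0 andbT negbK => /eqP Dv.
  rewrite big1 => [|c /andP[cr /eqP cv]]; last first.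
    by have := tree_value_gt0 rt DE cr; rewrite cv Dv ltxx.
  have [vr|vr] := eqVneq v r; last by rewrite bE // Dv sqrtr0 mulr0 mul0r.
  by have := Dr0; rewrite -vr Dv ltxx.
rewrite (eq_bigr (fun c => b v / D v * branch (ell [set c; par c]) (D c))).
  by rewrite -mulr_sumr -DE divfK // gt_eqF.
move=> c /andP[cr /eqP <-]; rewrite (BE cr) (bE cr) /branch; ring.
Qed.

(* Along every edge the weight spent is the drop of [D v / b v], the radius of
   the subtree hanging at [v] under its share [b v] of the budget.  At a leaf
   this is 0 / 0 = 0, the right value. *)
Lemma budget_omega c : c != r -> omega ell B [set c; par c] =
  (D (par c) / b (par c) - D c / b c)%:E.
Proof.
move=> cr; rewrite /omega gt_eqF ?B_gt0 //; congr EFin.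
have q_gt0 := q0 cr; have bp := b_par cr.
have Dp := tree_value_gt0 rt DE cr.
rewrite BE // -{1}(@sqr_sqrtr _ (ell [set c; par c])); last first.
  by apply/ltW/ell_gt0/(par_edge rt).
have [Dc|Dc] := eqVneq (D c) 0.
  by rewrite Dc sqrtr0 mul0r subr0; field; rewrite !gt_eqF // addr0.
have s_gt0 : 0 < Num.sqrt (D c) by rewrite sqrtr_gt0 lt_def Dc D0.
rewrite (bE cr) -{2}(@sqr_sqrtr _ (D c)) //.
by field; rewrite !gt_eqF // addr_gt0.
Qed.

Lemma wr_upper_bound : (wr E ell B r <= (D r)%:E)%E.
Proof.
(* The differences in [budget_omega] telescope along the path of ancestors. The bound on heights is
   there to keep the path simple when a child is appended. *)
have pathP v : exists p, [/\ simple_path E r v p,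
    forall x, x \in r :: p -> (h x <= h v)%N
  & path_weight ell B r p = (D r / b r - D v / b v)%:E].
  elim/(rooting_ind_down rt): v => [|c cr [p [/and3P[pP pU /eqP lp] hp wp]]].
    exists [::]; split; rewrite /simple_path ?eqxx //=.
      by move=> x; rewrite inE => /eqP->.
    by rewrite /path_weight big_nil subrr.
  have hc x : x \in r :: p -> (h x < h c)%N.
    by move=> /hp hx; apply: leq_ltn_trans hx (par_lt rt cr).
  exists (rcons p c); split.
  - rewrite /simple_path rcons_path last_rcons eqxx pP lp -rcons_cons rcons_uniq pU.
    rewrite /adj /= finset.setUC (par_edge rt) //= !andbT.
    by apply/negP => /hc; rewrite ltnn.
  - move=> x; rewrite -rcons_cons mem_rcons inE => /orP[/eqP->//|/hc/ltnW//].
  - rewrite path_weight_rcons wp lp finset.setUC budget_omega // -EFinD.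
    by congr EFin; ring.
apply: bigmax_le => [|v _]; first exact: leNye.
have [p [sp _ wp]] := pathP v.
rewrite /delta ge_ereal_inf //; exists (path_weight ell B r p); first by exists p.
by rewrite wp lee_fin br divr1 gerBl divr_ge0 // (b_gt0 v).1.
Qed.
End Upper.

End Value.


(** * Running programs *)

Section Run.
Variable R : realType.
Implicit Types s : state R.

Fixpoint straight (c : cmd) : bool :=
  match c with
  | CSeq c1 c2 | CIf _ c1 c2 => straight c1 && straight c2
  | CWhile _ _ => false
  | _ => true
  end.

(* Meaningful for straight-line commands only. *)
Fixpoint run (c : cmd) s : state R :=
  match c with
  | CSkip | CWhile _ _ => s
  | CISet x e => set_ivar s x (ieval s e)
  | CIPut a i e => set_iarr s a (ieval s i) (ieval s e)
  | CRSet x e => set_rvar s x (reval s e)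
  | CRPut a i e => set_rarr s a (ieval s i) (reval s e)
  | CSeq c1 c2 => run c2 (run c1 s)
  | CIf b c1 c2 => if beval s b then run c1 s else run c2 s
  end.

(* A bound on the time per unit of input size, provided that every loop runs
   at most as many times as the input size. *)
Fixpoint cost (c : cmd) : nat :=
  (match c with
  | CSkip => 1
  | CISet _ e => (icost e).+1
  | CIPut _ i e => (icost i + icost e).+1
  | CRSet _ e => (rcost e).+1
  | CRPut _ i e => (icost i + rcost e).+1
  | CSeq c1 c2 => cost c1 + cost c2
  | CIf b c1 c2 => bcost b + (cost c1 + cost c2)
  | CWhile b c => (bcost b + cost c) * 2
  end)%N.

Variable N : nat.
Hypothesis N_gt0 : (0 < N)%N.

Definition halts (c : cmd) s (Q : state R -> Prop) :=
  exists t s', [/\ exec c s t s', (t <= cost c * N)%N & Q s'].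

Lemma straight_exec c s : straight c ->
  exists2 t, exec c s t (run c s) & (t <= cost c)%N.
Proof.
elim: c s => //=.
- by move=> s _; exists 1%N => //; constructor.
- by move=> x e s _; eexists; first by constructor.
- by move=> a i e s _; eexists; first by constructor.
- by move=> x e s _; eexists; first by constructor.
- by move=> a i e s _; eexists; first by constructor.
- move=> c1 IH1 c2 IH2 s /andP[/(IH1 s)[t1 e1 h1] /(IH2 (run c1 s))[t2 e2 h2]].
  by exists (t1 + t2)%N; [exact: exec_seq e1 e2 | exact: leq_add].
- move=> b c1 IH1 c2 IH2 s /andP[/(IH1 s)[t1 e1 h1] /(IH2 s)[t2 e2 h2]].
  case: ifP => bs.
    by exists (bcost b + t1)%N; [constructor; rewrite bs | lia].
  by exists (bcost b + t2)%N; [constructor; rewrite bs | lia].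
Qed.

Lemma halts_straight c s (Q : state R -> Prop) :
  straight c -> Q (run c s) -> halts c s Q.
Proof.
move=> /(straight_exec s)[t e h] q; exists t, (run c s); split => //.
exact: leq_trans h (leq_pmulr _ N_gt0).
Qed.

Lemma halts_seq c1 c2 s (Q1 Q2 : state R -> Prop) : halts c1 s Q1 ->
  (forall s', Q1 s' -> halts c2 s' Q2) -> halts (CSeq c1 c2) s Q2.
Proof.
move=> [t1 [s1 [e1 h1 q1]]] /(_ _ q1)[t2 [s2 [e2 h2 q2]]].
exists (t1 + t2)%N, s2; split => //; first exact: exec_seq e1 e2.
by rewrite mulnDl leq_add.
Qed.

Fixpoint keeps_counter (c : cmd) : bool :=
  match c with
  | CISet x _ => x != 3%N
  | CSeq c1 c2 | CIf _ c1 c2 => keeps_counter c1 && keeps_counter c2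
  | _ => true
  end.

Lemma run_counter c s : keeps_counter c -> ivar (run c s) 3 = ivar s 3.
Proof.
elim: c s => //=.
- by move=> x e s x3; rewrite /upd /= eq_sym (negbTE x3).
- by move=> c1 IH1 c2 IH2 s /andP[/IH1 h1 /IH2 h2]; rewrite h2.
- by move=> b c1 IH1 c2 IH2 s /andP[/IH1 h1 /IH2 h2]; case: ifP.
Qed.

Definition For (bnd : iexp) (body : cmd) : cmd :=
  CSeq (CISet 3 (IConst 0)) (CWhile (BILt (IVar 3) bnd)
    (CSeq body (CISet 3 (IAdd (IVar 3) (IConst 1))))).

(** [bnd] is evaluated again before every round, so the invariant has to fix its value. *)
Lemma halts_for bnd body s n (Inv : nat -> state R -> Prop) :
  straight body -> keeps_counter body -> (n <= N)%N ->
  (forall k s, Inv k s -> ieval s bnd = n) ->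
  Inv 0%N (set_ivar s 3 0%N) ->
  (forall k s, (k < n)%N -> ivar s 3 = k -> Inv k s ->
    Inv k.+1 (set_ivar (run body s) 3 k.+1)) ->
  halts (For bnd body) s (Inv n).
Proof.
move=> sb fb nN bndP Inv0 InvS.
apply: (@halts_seq _ _ _ (fun s' => Inv 0%N s' /\ ivar s' 3 = 0%N)).
  exact: halts_straight.
move=> {Inv0} {}s [Inv0 s3].
set b := BILt _ _; set c := CSeq _ _.
suff H d : forall k s, (k + d = n)%N -> Inv k s -> ivar s 3 = k ->
    exists t s', [/\ exec (CWhile b c) s t s',
      (t <= (bcost b + cost c) * d + bcost b)%N & Inv n s'].
  have [t [s' [e h q]]] := H n 0%N s (add0n _) Inv0 s3; exists t, s'; split => //.
  rewrite /= -/b -/c in h *.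
  (* The factor 2 in [cost] pays for the last, failing test, since [n <= N] and [0 < N]. *)
  apply: leq_trans h _; move: (bcost b) (cost c) => x y.
  by nia.
elim: d => [|d IH] k {Inv0 s3}s kd Ik sk.
  exists (bcost b), s; split; rewrite ?muln0 //; last by rewrite -kd addn0.
  by apply: exec_while_false; rewrite /= sk (bndP _ _ Ik) -kd addn0 ltnn.
have kn : (k < n)%N by rewrite -kd addnS ltnS leq_addr.
have Ik' := InvS k s kn sk Ik.
have sc : straight c by rewrite /= sb.
have [t1 e1 h1] := straight_exec s sc.
have er : run c s = set_ivar (run body s) 3 k.+1 by rewrite /= run_counter // sk addn1.
rewrite er in e1.
have [|t2 [s2 [e2 h2 q2]]] := IH k.+1 _ _ Ik' erefl; first by rewrite -kd addnS addSn.
exists (bcost b + t1 + t2)%N, s2; split => //; last by nia.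
by apply: exec_while_true e1 e2; rewrite /= sk (bndP _ _ Ik).
Qed.

(** Rules for symbolic execution, one command at a time. They act on the head of a [CSeq], which is
    why the blocks of the program end in [CSkip]; [run_if] keeps a single copy of the continuation
    until the test is decided. *)
Lemma run_iset x e c s :
  run (CSeq (CISet x e) c) s = run c (set_ivar s x (ieval s e)).
Proof. by []. Qed.

Lemma run_iput a i e c s :
  run (CSeq (CIPut a i e) c) s = run c (set_iarr s a (ieval s i) (ieval s e)).
Proof. by []. Qed.

Lemma run_rset x e c s :
  run (CSeq (CRSet x e) c) s = run c (set_rvar s x (reval s e)).
Proof. by []. Qed.

Lemma run_rput a i e c s :
  run (CSeq (CRPut a i e) c) s = run c (set_rarr s a (ieval s i) (reval s e)).
Proof. by []. Qed.

Lemma run_if b c1 c2 c s :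
  run (CSeq (CIf b c1 c2) c) s = run (CSeq (if beval s b then c1 else c2) c) s.
Proof. by rewrite /=; case: ifP. Qed.

Lemma run_seqA c1 c2 c s :
  run (CSeq (CSeq c1 c2) c) s = run (CSeq c1 (CSeq c2 c)) s.
Proof. by []. Qed.

Lemma run_seq_skip c s : run (CSeq CSkip c) s = run c s.
Proof. by []. Qed.

Lemma run_skip s : run CSkip s = s.
Proof. by []. Qed.

(* [Nat.eqb] rather than [==]: it is evaluated by [/=] on the concrete names. *)
Let upd_eqb (T : Type) (f : nat -> T) i x j :
  upd f i x j = if Nat.eqb j i then x else f j.
Proof.
rewrite /upd /=; case: eqP => [->|ji]; first by rewrite PeanoNat.Nat.eqb_refl.
by case: PeanoNat.Nat.eqb_spec.
Qed.

Lemma ivar_set_ivar s x k y :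
  ivar (set_ivar s x k) y = if Nat.eqb y x then k else ivar s y.
Proof. exact: upd_eqb. Qed.
Lemma iarr_set_iarr s a i k b :
  iarr (set_iarr s a i k) b = if Nat.eqb b a then upd (iarr s a) i k else iarr s b.
Proof. exact: upd_eqb. Qed.
Lemma rvar_set_rvar s x k y :
  rvar (set_rvar s x k) y = if Nat.eqb y x then k else rvar s y.
Proof. exact: upd_eqb. Qed.
Lemma rarr_set_rarr s a i k b :
  rarr (set_rarr s a i k) b = if Nat.eqb b a then upd (rarr s a) i k else rarr s b.
Proof. exact: upd_eqb. Qed.

Lemma ivar_set_iarr s a i z : ivar (set_iarr s a i z) = ivar s. Proof. by []. Qed.
Lemma ivar_set_rvar s x z : ivar (set_rvar s x z) = ivar s. Proof. by []. Qed.
Lemma ivar_set_rarr s a i z : ivar (set_rarr s a i z) = ivar s. Proof. by []. Qed.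
Lemma iarr_set_ivar s x z : iarr (set_ivar s x z) = iarr s. Proof. by []. Qed.
Lemma iarr_set_rvar s x z : iarr (set_rvar s x z) = iarr s. Proof. by []. Qed.
Lemma iarr_set_rarr s a i z : iarr (set_rarr s a i z) = iarr s. Proof. by []. Qed.
Lemma rvar_set_ivar s x z : rvar (set_ivar s x z) = rvar s. Proof. by []. Qed.
Lemma rvar_set_iarr s a i z : rvar (set_iarr s a i z) = rvar s. Proof. by []. Qed.
Lemma rvar_set_rarr s a i z : rvar (set_rarr s a i z) = rvar s. Proof. by []. Qed.
Lemma rarr_set_ivar s x z : rarr (set_ivar s x z) = rarr s. Proof. by []. Qed.
Lemma rarr_set_iarr s a i z : rarr (set_iarr s a i z) = rarr s. Proof. by []. Qed.
Lemma rarr_set_rvar s x z : rarr (set_rvar s x z) = rarr s. Proof. by []. Qed.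

End Run.

Definition projE := (ivar_set_ivar, iarr_set_iarr, rvar_set_rvar, rarr_set_rarr,
  ivar_set_iarr, ivar_set_rvar, ivar_set_rarr, iarr_set_ivar, iarr_set_rvar,
  iarr_set_rarr, rvar_set_ivar, rvar_set_iarr, rvar_set_rarr, rarr_set_ivar,
  rarr_set_iarr, rarr_set_rvar).

Lemma updE (T : Type) (f : nat -> T) i x j :
  upd f i x j = if j == i then x else f j.
Proof. by []. Qed.

Opaque run set_ivar set_iarr set_rvar set_rarr upd.

Ltac proj := cbn [ieval reval beval Nat.eqb];
  repeat progress (rewrite ?projE; cbn [Nat.eqb]).
Ltac run_step H :=
  rewrite (run_iset, run_iput, run_rset, run_rput, run_if, run_seqA, run_seq_skip, run_skip);
  proj; rewrite ?H.

(** * The program *)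

(* Index variables: 0 and 1, the numbers of vertices and edges; 2, the root;
   3, the loop counter; 4, the length of the queue; 5 and 6, the vertex being
   treated and its parent; 8, the best root so far.
   Index arrays: 0 and 1, the ends of the edges; 2, the degrees; 3 and 4, the
   sums of the neighbours and of the incident edges; 5, the queue.
   Real arrays: 0, the lengths and finally the budgets; 1, the value of the
   subtree hanging at a vertex; 2, the square root of the length of the edge to
   the parent; 3, the value of the tree rooted at a vertex, and later the share
   of the budget spent below a vertex. *)

Local Notation "c1 ;; c2" := (CSeq c1 c2) (at level 61, right associativity).
Local Notation II := (IVar 3).
Local Notation N1 := (IConst 1).

Definition incr (a : nat) (i e : iexp) := CIPut a i (IAdd (IGet a i) e).
Definition decr (a : nat) (i e : iexp) := CIPut a i (ISub (IGet a i) e).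
Definition push := CIPut 5 (IVar 4) (IVar 6);; CISet 4 (IAdd (IVar 4) N1).

(** The second call of [strip] finds the remains of the first in these arrays. *)
Definition strip_init := CIPut 2 II (IConst 0);; CIPut 3 II (IConst 0);;
  CIPut 4 II (IConst 0);; CRPut 1 II (RConst 0);; CSkip.

Definition strip_edge := CISet 5 (IGet 0 II);; CISet 6 (IGet 1 II);;
  incr 2 (IVar 5) N1;; incr 3 (IVar 5) (IVar 6);; incr 4 (IVar 5) II;;
  incr 2 (IVar 6) N1;; incr 3 (IVar 6) (IVar 5);; incr 4 (IVar 6) II;; CSkip.

Definition strip_leaves := CISet 6 II;;
  CIf (BIEq (IGet 2 II) N1) push CSkip;; CSkip.

Definition rbranch := RAdd (RGet 2 (IVar 5)) (RSqrt (RGet 1 (IVar 5))).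

Definition strip_step := CISet 5 (IGet 5 II);; CISet 6 (IGet 3 (IVar 5));;
  CRPut 2 (IVar 5) (RSqrt (RGet 0 (IGet 4 (IVar 5))));;
  CRPut 1 (IVar 6) (RAdd (RGet 1 (IVar 6)) (RMul rbranch rbranch));;
  decr 2 (IVar 6) N1;; decr 3 (IVar 6) (IVar 5);;
  decr 4 (IVar 6) (IGet 4 (IVar 5));;
  CIf (BIEq (IGet 2 (IVar 6)) N1) push CSkip;; CSkip.

(* Keeping only sums of neighbours and incident edges avoids adjacency lists:
   once a vertex is a leaf these sums are its parent and the edge to it.  The
   degree of the root is raised by one so that the root is stripped last. *)
Definition strip := For (IVar 0) strip_init;; For (IVar 1) strip_edge;;
  (incr 2 (IVar 2) N1;; CISet 4 (IConst 0);; CSkip);;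
  For (IVar 0) strip_leaves;; For (ISub (IVar 0) N1) strip_step.


(* Calls of [strip] leave the vertices in the queue in such an order that
   backwards every vertex comes after its parent. *)
Definition load_backwards :=
  CISet 5 (IGet 5 (ISub (ISub (IVar 0) (IConst 2)) II));;
  CISet 6 (IGet 3 (IVar 5)).

Definition reroot_step := load_backwards;;
  CRSet 0 (RMul rbranch rbranch);;
  CRSet 1 (RAdd (RGet 2 (IVar 5)) (RSqrt (RSub (RGet 3 (IVar 6)) (RVar 0))));;
  CRPut 3 (IVar 5) (RAdd (RGet 1 (IVar 5)) (RMul (RVar 1) (RVar 1)));;
  CIf (BRLt (RGet 3 (IVar 5)) (RGet 3 (IVar 8))) (CISet 8 (IVar 5)) CSkip;; CSkip.

Definition budget_step := load_backwards;;
  CRSet 0 (RMul (RGet 3 (IVar 6)) rbranch);;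
  CRPut 0 (IGet 4 (IVar 5))
    (RDiv (RMul (RVar 0) (RGet 2 (IVar 5))) (RGet 1 (IVar 6)));;
  CRPut 3 (IVar 5)
    (RDiv (RMul (RVar 0) (RSqrt (RGet 1 (IVar 5)))) (RGet 1 (IVar 6)));; CSkip.

(** Parents, stripping order and subtree values all refer to a root, so they are recomputed for the
    best one. The lengths are still in place at that point, as budgets are written only
    afterwards. *)
Definition optimal_allocation := strip;;
  (CRPut 3 (IVar 2) (RGet 1 (IVar 2));; CISet 8 (IVar 2);; CSkip);;
  For (ISub (IVar 0) N1) reroot_step;;
  (CISet 2 (IVar 8);; CSkip);;
  strip;;
  (CRPut 3 (IVar 2) (RConst 1);; CSkip);;
  For (ISub (IVar 0) N1) budget_step;;
  (CISet 0 (IVar 2);; CSkip).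


(** * Leaf stripping *)

Section Order.
Variables (V : finType) (E : {set {set V}}) (r : V) (par : V -> V) (h : V -> nat).
Hypothesis rt : rooting E r par h.
Local Notation ch v c := ((c != r) && (par c == v)).

Definition kids (d : seq V) (v : V) : nat := (\sum_(c | ch v c && (c \notin d)) 1)%N.

(* The state of the queue [q] once its first [k] vertices are stripped. *)
Record strip_order (k : nat) (q : seq V) : Prop := StripOrder {
  so_uniq : uniq q;
  so_size : (k <= size q)%N;
  so_leaf : forall v, (v \in q) = (kids (take k q) v == 0%N);
  so_par : forall j, (j < k)%N ->
    (nth r q j != r) && (par (nth r q j) \notin take j.+1 q)
}.

Lemma kids0P d v : reflect (forall c, c != r -> par c = v -> c \in d) (kids d v == 0%N).
Proof.
rewrite sum_nat_eq0; apply: (iffP forallP) => [H c cr cv|H c].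
  by have := H c; rewrite cr cv eqxx /= implybF negbK.
by apply/implyP => /andP[/andP[cr /eqP cv]]; rewrite H.
Qed.

(** Stripping [u] affects the sum at its parent only, which matches the update of a single array
    cell. *)
Lemma alive_split (T : nmodType) (g : V -> T) d u v : u != r -> u \notin d ->
  \sum_(c | ch v c && (c \notin d)) g c =
    (if par u == v then g u else 0) +
    \sum_(c | ch v c && (c \notin rcons d u)) g c.
Proof.
move=> ur ud; have aux c : ch v c && (c \notin rcons d u) = ch v c && (c \notin d) && (c != u).
  by rewrite mem_rcons inE negb_or [X in _ && X = _]andbC andbA.
rewrite (eq_bigl _ _ aux); case: ifPn => uv; first by rewrite (bigD1 u) //= ur uv ud.
rewrite add0r; apply: eq_bigl => c; case: (eqVneq c u) => [->|]; rewrite ?andbT //.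
by rewrite (negbTE uv) andbF.
Qed.

Lemma dead_split (T : nmodType) (g : V -> T) d u v : u != r -> u \notin d ->
  \sum_(c | ch v c && (c \in rcons d u)) g c =
    (if par u == v then g u else 0) + \sum_(c | ch v c && (c \in d)) g c.
Proof.
move=> ur ud; have aux c : ch v c && (c \in d) = ch v c && (c \in rcons d u) && (c != u).
  rewrite mem_rcons inE; case: (eqVneq c u) => [->|]; last by rewrite andbT.
  by rewrite (negbTE ud) !andbF.
rewrite (eq_bigl _ _ aux); case: ifPn => uv.
  by rewrite (bigD1 u) //= ur uv mem_rcons mem_head.
rewrite add0r; apply: eq_bigl => c; case: (eqVneq c u) => [->|]; rewrite ?andbT //.
by rewrite (negbTE uv) andbF.
Qed.

Lemma kids_split d u v : u != r -> u \notin d ->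
  kids d v = ((par u == v) + kids (rcons d u) v)%N.
Proof.
by move=> ur ud; rewrite /kids (alive_split (fun=> 1%N) v ur ud); case: eqP.
Qed.

Lemma strip_order_next k q : strip_order k q -> (k.+1 < #|V|)%N ->
  let u := nth r q k in
  [/\ (k < size q)%N, u != r, u \notin take k q, par u \notin q
  & strip_order k.+1
      (if kids (rcons (take k q) u) (par u) == 0%N then rcons q (par u) else q)].
Proof.
move=> [Uq Sq Lq Pq] kn u.
have [x xr xA] : exists2 x, x != r & x \notin take k q.
  have : (1 < #|~: [set y in take k q]%SET|)%N.
    have := cardsC [set y in take k q]%SET.
    have : (#|[set y in take k q]%SET| <= k)%N.
      by rewrite cardsE (leq_trans (card_size _)) // size_take; case: ltnP.
    lia.
  case/card_gt1P => y [z [+ + yz]]; rewrite !inE => yA zA.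
  have [yr|] := eqVneq y r; last by exists y.
  by exists z => //; rewrite -yr eq_sym.
(* An unstripped non-root vertex of greatest height has no unstripped child, so it waits in the
   queue: the queue has not run dry. *)
have kq : (k < size q)%N.
  have Px : (x \notin take k q) && (x != r) by rewrite xA xr.
  case: (arg_maxnP (P := fun y => (y \notin take k q) && (y != r)) h Px) => y /andP[yA yr] ymax.
  have : y \in q.
    rewrite Lq; apply/kids0P => c cr cy; apply/negPn/negP => cA.
    by have := ymax c; rewrite cA cr /geq /= leqNgt -cy (par_lt rt cr) => /(_ isT).
  by apply: contraTT; rewrite -leqNgt => /take_oversize qk; rewrite -qk.
have uq : u \in q by exact: mem_nth.
have uA : u \notin take k q.
  have := Uq; rewrite -{1}(cat_take_drop k q) (drop_nth r kq) cat_uniq /=.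
  by case/and3P => _; rewrite negb_or => /andP[].
(* If the root were next, all its children would be stripped, then all of theirs, and so on down to
   [x]. *)
have ur : u != r.
  apply: contraNneq xA => ur; have := uq; rewrite ur Lq => /kids0P rk.
  move: x {xr} (xr); apply: (rooting_ind_down rt); first by rewrite eqxx.
  move=> c cr IHc _; have [pr|pr] := eqVneq (par c) r; first exact: rk.
  have := mem_take (IHc pr); rewrite Lq => /kids0P; exact.
have pq : par u \notin q.
  by rewrite Lq; apply: contra uA => /kids0P; exact.
split=> //.
set t := if _ then _ else _.
have [t' tE] : exists t', t = q ++ t'.
  rewrite /t; case: ifP => _; last by exists [::]; rewrite cats0.
  by exists [:: par u]; rewrite cats1.
have tkt j : (j <= k)%N -> take j.+1 t = take j.+1 q.
  by move=> jk; rewrite tE takel_cat // (leq_ltn_trans jk).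
have ntht j : (j <= k)%N -> nth r t j = nth r q j.
  by move=> jk; rewrite tE nth_cat (leq_ltn_trans jk).
have tk1 : take k.+1 q = rcons (take k q) u by rewrite (take_nth r).
split.
- by rewrite /t; case: ifP => // _; rewrite rcons_uniq pq.
- by rewrite tE size_cat ltn_addr.
- move=> v; rewrite tkt // tk1; have := Lq v; rewrite (kids_split v ur uA).
  rewrite /t; have [<-|pv] := eqVneq (par u) v.
    by case: ifP => _; rewrite ?(negbTE pq) // mem_rcons mem_head.
  by case: ifP => _; rewrite // mem_rcons inE [v == par u]eq_sym (negbTE pv).
- move=> j; rewrite ltnS leq_eqVlt => /orP[/eqP->|jk].
    by rewrite ntht // tkt // ur tk1 -tk1 (contra (@mem_take _ _ _ _)).
  by rewrite ntht ?tkt ?Pq // ltnW.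
Qed.

Lemma strip_order_end q : strip_order #|V|.-1 q ->
  [/\ uniq (take #|V|.-1 q), size (take #|V|.-1 q) = #|V|.-1
    & forall v, (v \in take #|V|.-1 q) = (v != r)].
Proof.
move=> [Uq Sq _ Pq]; set d := take _ q.
have Ud : uniq d by exact: take_uniq.
have Sd : size d = #|V|.-1 by rewrite size_takel.
have sub : {subset d <= enum (predC1 r)}.
  move=> v vd; rewrite mem_enum !inE.
  have := Pq (index v d); rewrite -Sd index_mem => /(_ vd)/andP[+ _].
  have id : (index v d < #|V|.-1)%N by rewrite -Sd index_mem.
  by rewrite -(nth_take r id) nth_index.
have [|_ mem_d] := uniq_min_size Ud sub; first by rewrite -cardE cardC1 Sd.
by split=> // v; rewrite mem_d mem_enum !inE.
Qed.
End Order.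


(** * Invariants of the machine passes *)

Section Machine.
Variables (R : realType) (V : finType) (E : {set {set V}}).
Variables (ell : {set V} -> R) (vs : seq V) (es : seq (V * V)).
Hypothesis E2 : forall e, e \in E -> #|e| = 2%N.
Hypothesis V1 : (1 < #|V|)%N.
Hypothesis vs_perm : perm_eq vs (enum V).
Hypothesis es_perm : perm_eq (map (@edge_of V) es) (enum E).
Implicit Types (s : state R) (r u v : V).

Let ix v := index v vs.
Let jx u v := index [set u; v]%SET (map (@edge_of V) es).
Let N := (#|V| + #|E|)%N.

Lemma size_vs : size vs = #|V|. Proof. by rewrite (perm_size vs_perm) cardE. Qed.
Lemma size_es : size es = #|E|.
Proof. by rewrite -(size_map (@edge_of V)) (perm_size es_perm) cardE. Qed.
Lemma vs_uniq : uniq vs. Proof. by rewrite (perm_uniq vs_perm) enum_uniq. Qed.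
Lemma mem_vs v : v \in vs. Proof. by rewrite (perm_mem vs_perm) mem_enum. Qed.
Lemma ix_lt v : (ix v < #|V|)%N. Proof. by rewrite -size_vs index_mem mem_vs. Qed.
Lemma ixK x0 v : nth x0 vs (ix v) = v. Proof. by rewrite nth_index ?mem_vs. Qed.
Lemma ix_nth x0 i : (i < #|V|)%N -> ix (nth x0 vs i) = i.
Proof. by rewrite -size_vs => ?; rewrite /ix index_uniq ?vs_uniq. Qed.
Lemma ix_eq u v : (ix u == ix v) = (u == v).
Proof.
by apply/eqP/eqP => [uv|->//]; rewrite -(ixK u u) uv ixK.
Qed.

Lemma edges_uniq : uniq (map (@edge_of V) es).
Proof. by rewrite (perm_uniq es_perm) enum_uniq. Qed.
Lemma mem_edges e : (e \in map (@edge_of V) es) = (e \in E).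
Proof. by rewrite (perm_mem es_perm) mem_enum. Qed.
Lemma jxC u v : jx u v = jx v u. Proof. by rewrite /jx finset.setUC. Qed.
Lemma jx_nth p0 k : (k < size es)%N -> jx (nth p0 es k).1 (nth p0 es k).2 = k.
Proof.
move=> km; rewrite /jx -[[set _; _]%SET]/(edge_of (nth p0 es k)).
by rewrite -(nth_map p0 finset.set0) // index_uniq ?size_map ?edges_uniq.
Qed.
Lemma edge_neq u v : [set u; v]%SET \in E -> u != v.
Proof. by move=> /E2; rewrite cards2; case: (u == v). Qed.

(* Indices 0 and 1 of the index arrays and index 0 of the real arrays hold the
   input. *)
Record base r s : Prop := Base {
  base_n : ivar s 0 = #|V|;
  base_m : ivar s 1 = size es;
  base_r : ivar s 2 = ix r;
  base_src : forall p0 k, (k < size es)%N -> iarr s 0 k = ix (nth p0 es k).1;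
  base_dst : forall p0 k, (k < size es)%N -> iarr s 1 k = ix (nth p0 es k).2;
  base_len : forall u v, [set u; v]%SET \in E -> rarr s 0 (jx u v) = ell [set u; v]
}.

Variables (r : V) (par : V -> V) (h : V -> nat) (D : V -> R).
Hypothesis rt : rooting E r par h.
Hypothesis DE : tree_value ell r par D.

Local Notation ch v c := ((c != r) && (par c == v)).

(** The sum over the neighbours still present; [g] yields the position of the neighbour, the
    position of the edge to it, or 1 for the degree. *)
Definition nbr_sum (g : V -> V -> nat) (d : seq V) v : nat :=
  ((if v != r then g v (par v) else 0) + \sum_(c | ch v c && (c \notin d)) g v c)%N.

Definition partial_sum (g : V -> V -> nat) k v : nat :=
  (\sum_(p <- take k es)
    ((if p.1 == v then g v p.2 else 0) + (if p.2 == v then g v p.1 else 0)))%N.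

Lemma partial_sum0 g v : partial_sum g 0 v = 0%N.
Proof. by rewrite /partial_sum take0 big_nil. Qed.

Lemma partial_sumS p0 g k v : (k < size es)%N ->
  partial_sum g k.+1 v = (partial_sum g k v +
    ((if (nth p0 es k).1 == v then g v (nth p0 es k).2 else 0) +
     (if (nth p0 es k).2 == v then g v (nth p0 es k).1 else 0)))%N.
Proof.
by move=> km; rewrite /partial_sum (take_nth p0 km) -cats1 big_cat big_seq1.
Qed.

Lemma partial_sum_size g v : partial_sum g (size es) v = nbr_sum g [::] v.
Proof.
rewrite /partial_sum take_size.
pose F a b := ((if a == v then g v b else 0) + (if b == v then g v a else 0))%N.
transitivity (\sum_(p <- es) F p.1 p.2); first by [].
rewrite (big_edge_list rt E2 es_perm) => [|a b]; last by rewrite /F addnC.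
rewrite /F big_split /=; congr (_ + _)%N.
  rewrite -big_mkcondr /=; case: ifPn => vr.
    rewrite (big_pred1 v) // => c /=.
    by case: (eqVneq c v) => [->|_]; rewrite ?vr ?andbF.
  by rewrite big1 // => c /andP[cr /eqP cv]; rewrite -cv cr in vr.
by rewrite -big_mkcondr /=; apply: eq_bigl => c; rewrite andbT.
Qed.

Lemma nbr_sum_split g d u v : u != r -> u \notin d ->
  nbr_sum g d v =
    ((if par u == v then g v u else 0) + nbr_sum g (rcons d u) v)%N.
Proof.
move=> ur ud; rewrite /nbr_sum (alive_split par (g v) v ur ud).
by rewrite addnCA.
Qed.

Record stripping (d : seq V) s : Prop := Stripping {
  st_deg : forall v, iarr s 2 (ix v) = (kids r par d v).+1;
  st_nb : forall v, iarr s 3 (ix v) = nbr_sum (fun _ y => ix y) d v;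
  st_ed : forall v, iarr s 4 (ix v) = nbr_sum jx d v;
  st_D : forall v, rarr s 1 (ix v) = \sum_(c | ch v c && (c \in d))
    branch (ell [set c; par c]%SET) (D c)
}.

Record queue (q : seq V) s : Prop := Queue {
  qu_size : ivar s 4 = size q;
  qu_nth : forall j, (j < size q)%N -> iarr s 5 j = ix (nth r q j)
}.

Lemma queue_push q v s s' : queue q s -> iarr s' 5 = upd (iarr s 5) (size q) (ix v) ->
  ivar s' 4 = (size q).+1 -> queue (rcons q v) s'.
Proof.
move=> [Q4 Q5] s5 s4; split; rewrite ?size_rcons // => j; rewrite ltnS leq_eqVlt s5 updE.
by case: eqP => [->|_] /= jq; rewrite nth_rcons ?ltnn ?eqxx // jq Q5.
Qed.

Record init_inv k s : Prop := InitInv {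
  ii_base : base r s;
  ii_zero : forall i, (i < k)%N ->
    [/\ iarr s 2 i = 0%N, iarr s 3 i = 0%N, iarr s 4 i = 0%N & rarr s 1 i = 0]
}.

Record edge_inv k s : Prop := EdgeInv {
  ei_base : base r s;
  ei_deg : forall v, iarr s 2 (ix v) = partial_sum (fun _ _ => 1%N) k v;
  ei_nb : forall v, iarr s 3 (ix v) = partial_sum (fun _ y => ix y) k v;
  ei_ed : forall v, iarr s 4 (ix v) = partial_sum jx k v;
  ei_D : forall v, rarr s 1 (ix v) = 0
}.

Record leaf_inv k s : Prop := LeafInv {
  li_base : base r s;
  li_strip : stripping [::] s;
  li_queue : queue [seq v <- take k vs | kids r par [::] v == 0%N] s
}.

Record step_inv k s : Prop := StepInv {
  si_base : base r s;
  si_step : exists q, [/\ strip_order r par k q, queue q s, stripping (take k q) s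
    & forall v, v \in take k q -> rarr s 2 (ix v) = Num.sqrt (ell [set v; par v]%SET)]
}.

Record stripped (d : seq V) s : Prop := Stripped {
  sd_uniq : uniq d;
  sd_size : size d = #|V|.-1;
  sd_mem : forall v, (v \in d) = (v != r);
  sd_par : forall j, (j < #|V|.-1)%N -> par (nth r d j) \notin take j.+1 d;
  sd_queue : forall j, (j < #|V|.-1)%N -> iarr s 5 j = ix (nth r d j);
  sd_nb : forall v, v != r -> iarr s 3 (ix v) = ix (par v);
  sd_ed : forall v, v != r -> iarr s 4 (ix v) = jx v (par v);
  sd_q : forall v, v != r -> rarr s 2 (ix v) = Num.sqrt (ell [set v; par v]%SET);
  sd_D : forall v, rarr s 1 (ix v) = D v
}.

Ltac keep_base B := split; proj; first [ exact: (base_n B) | exact: (base_m B)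
  | exact: (base_r B) | exact: (base_src B) | exact: (base_dst B) | exact: (base_len B) ].

Let N_gt0 : (0 < N)%N. Proof. by rewrite /N; lia. Qed.

Lemma strip_init_halts s : base r s ->
  halts N (For (IVar 0) strip_init) s (init_inv #|V|).
Proof.
move=> B; apply: halts_for => //; first by rewrite leq_addr.
- by move=> k {B}s [B _]; exact: (base_n B).
- by split; [keep_base B |].
move=> k {B}s kn sk [B Z]; rewrite /strip_init; do ! run_step sk.
split; first keep_base B.
move=> i; rewrite ltnS leq_eqVlt; proj; rewrite !updE.
by case: eqP => [|_ /= /Z[]].
Qed.

Lemma strip_edge_halts s : init_inv #|V| s ->
  halts N (For (IVar 1) strip_edge) s (edge_inv (size es)).
Proof.
move=> [B Z]; apply: halts_for => //; first by rewrite size_es leq_addl.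
- by move=> k {B Z}s [B _ _ _ _]; exact: (base_m B).
- split; first keep_base B; proj; move=> v; rewrite ?partial_sum0; by have [] := Z _ (ix_lt v).
move=> k {B Z}s km sk [B deg nb ed D0].
have [p0 _] : exists p0 : V * V, true by exists (r, r).
have := jx_nth p0 km; have := base_src B p0 km; have := base_dst B p0 km.
have abE : [set (nth p0 es k).1; (nth p0 es k).2]%SET \in E.
  by rewrite -mem_edges -[[set _; _]%SET]/(edge_of (nth p0 es k)) map_f // mem_nth.
have := edge_neq abE; have := (fun g v => partial_sumS p0 g v km).
case: (nth p0 es k) abE => a b /= abE SS ab dst src jk.
(* The ends are distinct, so the increments at one end do not touch the cells of the other. *)
have pu : (ix b == ix a) = false by rewrite ix_eq eq_sym; exact: negbTE.
rewrite /strip_edge /incr; do ! run_step (sk, src, dst).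
split; first keep_base B.
- move=> v; proj; rewrite !updE pu !ix_eq SS -!deg !(eq_sym v).
  case: (eqVneq b v) => [<-|_]; first by rewrite (negbTE ab) addn1.
  by case: (eqVneq a v) => [->|_]; rewrite ?addn0.
- move=> v; proj; rewrite !updE pu !ix_eq SS -!nb !(eq_sym v).
  case: (eqVneq b v) => [<-|_]; first by rewrite (negbTE ab).
  by case: (eqVneq a v) => [->|_]; rewrite ?addn0.
- move=> v; proj; rewrite !updE pu !ix_eq SS -!ed !(eq_sym v).
  case: (eqVneq b v) => [<-|_]; first by rewrite (negbTE ab) jxC jk.
  by case: (eqVneq a v) => [<-|_]; rewrite ?addn0 ?jk.
- by move=> v; proj; exact: D0.
Qed.

Lemma strip_root_halts s : edge_inv (size es) s ->
  halts N (incr 2 (IVar 2) N1;; CISet 4 (IConst 0);; CSkip) s (leaf_inv 0).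
Proof.
move=> [B deg nb ed D0]; apply: halts_straight => //.
rewrite /incr; do ! run_step (base_r B).
split; first keep_base B.
  split=> v; proj; last by rewrite D0 big1 // => c; rewrite andbF.
  (* The successor in [st_deg] counts the parent of a non-root vertex, and the extra increment at
     [r]. *)
  - rewrite updE ix_eq deg partial_sum_size deg partial_sum_size /nbr_sum /kids.
    by have [->|_] := eqVneq v r; rewrite ?eqxx ?addn1.
  - by rewrite nb partial_sum_size.
  - by rewrite ed partial_sum_size.
by rewrite take0; split; proj.
Qed.

Lemma strip_leaves_halts s : leaf_inv 0 s ->
  halts N (For (IVar 0) strip_leaves) s (leaf_inv #|V|).
Proof.
move=> [B [deg nb ed D0] Q]; apply: halts_for => //; first by rewrite leq_addr.
- by move=> k {B deg nb ed D0 Q}s [B _ _]; exact: (base_n B).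
- split; first keep_base B; first by split=> v; proj.
  by move: Q; rewrite !take0 => -[]; split; proj.
move=> k {B deg nb ed D0 Q}s kn sk [B [deg nb ed D0] Q].
set v := nth r vs k; have kv : k = ix v by rewrite ix_nth.
rewrite /strip_leaves; do ! run_step sk.
rewrite kv deg.
have tk : take k.+1 vs = rcons (take k vs) v by rewrite (take_nth r) // size_vs.
move: Q; rewrite -kv.
case: ifPn => kids0 Q; rewrite /push; do ! run_step (qu_size Q).
  split; first keep_base B; first by split=> w; proj.
  rewrite tk filter_rcons; rewrite eqSS in kids0; rewrite kids0.
  by apply: queue_push Q _ _; proj; rewrite ?addn1 ?kv.
split; first keep_base B; first by split=> w; proj.
rewrite tk filter_rcons; rewrite eqSS in kids0; rewrite (negbTE kids0).
by case: Q; split; proj.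
Qed.

Lemma leaf_step_inv s : leaf_inv #|V| s -> step_inv 0 s.
Proof.
rewrite -size_vs => -[B S Q]; split=> //.
exists [seq v <- vs | kids r par [::] v == 0%N].
rewrite take_size in Q; rewrite take0; split => //.
split=> //; first exact/filter_uniq/vs_uniq.
by move=> v; rewrite mem_filter mem_vs andbT take0.
Qed.


Lemma nbr_sum_kids0 g d v : v != r -> kids r par d v == 0%N ->
  nbr_sum g d v = g v (par v).
Proof.
move=> vr /kids0P k0; rewrite /nbr_sum vr big1 ?addn0 // => c.
by move=> /andP[/andP[cr /eqP cv]]; rewrite k0.
Qed.

Lemma dead_sum_kids0 d v : kids r par d v == 0%N ->
  \sum_(c | ch v c && (c \in d)) branch (ell [set c; par c]%SET) (D c) = D v.
Proof.
move=> /kids0P k0; rewrite [RHS]DE; apply: eq_bigl => c.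
by case: (boolP (ch v c)) => //= /andP[cr /eqP cv]; rewrite k0.
Qed.

Lemma stripping_next d u s s' : u != r -> u \notin d -> stripping d s ->
  let b := Num.sqrt (ell [set u; par u]%SET) + Num.sqrt (D u) in
  iarr s' 2 = upd (iarr s 2) (ix (par u)) (iarr s 2 (ix (par u)) - 1)%N ->
  iarr s' 3 = upd (iarr s 3) (ix (par u)) (iarr s 3 (ix (par u)) - ix u)%N ->
  iarr s' 4 = upd (iarr s 4) (ix (par u)) (iarr s 4 (ix (par u)) - jx u (par u))%N ->
  rarr s' 1 = upd (rarr s 1) (ix (par u)) (rarr s 1 (ix (par u)) + b * b) ->
  stripping (rcons d u) s'.
Proof.
move=> ur ud [deg nb ed D0] b s2 s3 s4 s1.
split=> v; rewrite ?s2 ?s3 ?s4 ?s1 updE ix_eq [v == _]eq_sym.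
(* In this case and the next two, truncated subtraction is exact because it removes one of the
   summands. *)
- rewrite !deg !(kids_split par _ ur ud) eqxx subn1.
  by case: eqP => [->|].
- rewrite !nb !(nbr_sum_split _ _ ur ud) eqxx addKn.
  by case: eqP => [->|].
- rewrite !ed !(nbr_sum_split _ _ ur ud) eqxx jxC addKn.
  by case: eqP => [->|].
- rewrite !D0 !(dead_split par _ _ ur ud) /b -expr2 -/(branch _ _).
  by case: eqP => [->|]; rewrite ?add0r // addrC.
Qed.

Lemma strip_step_halts s : step_inv 0 s ->
  halts N (For (ISub (IVar 0) N1) strip_step) s (step_inv #|V|.-1).
Proof.
move=> S0; apply: halts_for => //; first by rewrite /N; lia.
- by move=> k {S0}s [B _] /=; rewrite (base_n B) subn1.
- case: S0 => B [q [O [Q4 Q5] [deg nb ed D0] sq]]; split; first keep_base B.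
  by exists q; split=> //; split; proj.
move=> k {S0}s kn sk [B [q [O Qu S sq]]].
have kn' : (k.+1 < #|V|)%N by lia.
have [kq ur ud pq O'] := strip_order_next rt O kn'.
set u := nth r q k in ur ud pq O' *; set d := take k q in ud O' S sq *.
have tk : take k.+1 q = rcons d u by rewrite (take_nth r).
(* Nothing is left below a queued vertex: its two sums are down to the term of the parent, and its
   subtree value is complete. *)
have ku : kids r par d u == 0%N by rewrite -(so_leaf O) mem_nth.
have upE : [set u; par u]%SET \in E by exact: par_edge rt _ ur.
have s5 : iarr s 5 k = ix u by rewrite (qu_nth Qu).
have s3 : iarr s 3 (ix u) = ix (par u) by rewrite (st_nb S) nbr_sum_kids0.
have s4 : iarr s 4 (ix u) = jx u (par u) by rewrite (st_ed S) nbr_sum_kids0.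
have s1 : rarr s 1 (ix u) = D u by rewrite (st_D S) dead_sum_kids0.
have s0 := base_len B upE.
have updK T (f : nat -> T) i x : upd f i x i = x by rewrite updE eqxx.
have degp : (iarr s 2 (ix (par u)) - 1 == 1)%N = (kids r par (rcons d u) (par u) == 0%N).
  by rewrite (st_deg S) (kids_split par _ ur ud) eqxx subn1 /= add1n eqSS.
rewrite /strip_step /decr /rbranch.
do ! run_step (sk, s5, s3, s4, s1, s0, updK).
rewrite degp; case: ifPn O' => kp O'; rewrite /push; do ! run_step (qu_size Qu).
  split; first keep_base B.
  exists (rcons q (par u)); have tk' : take k.+1 (rcons q (par u)) = rcons d u.
    by rewrite -cats1 takel_cat.
  split => //; rewrite ?tk'.
  - by apply: queue_push Qu _ _; proj; rewrite ?addn1.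
  - by apply: (stripping_next ur ud S); proj.
  - move=> v; rewrite mem_rcons inE; proj; rewrite updE ix_eq.
    by case: eqP => [->|_] //= /sq.
split; first keep_base B.
exists q; split => //; rewrite ?tk.
- by case: Qu; split; proj.
- by apply: (stripping_next ur ud S); proj.
- move=> v; rewrite mem_rcons inE; proj; rewrite updE ix_eq.
  by case: eqP => [->|_] //= /sq.
Qed.

Lemma step_inv_stripped s : step_inv #|V|.-1 s -> 
  exists d, base r s /\ stripped d s.
Proof.
move=> [B [q [O Qu [deg nb ed D0] sq]]].
have [Ud Sd memd] := strip_order_end O; set d := take _ q in Ud Sd memd nb ed D0 sq.
have k0 v : kids r par d v == 0%N by apply/kids0P => c cr _; rewrite memd.
exists d; split=> //; split=> //.
- move=> j jn; have /andP[_] := so_par O jn.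
  by rewrite /d nth_take // take_takel.
- move=> j jn; rewrite nth_take // (qu_nth Qu) // (leq_trans jn) //.
  exact: so_size O.
- by move=> v vr; rewrite nb nbr_sum_kids0.
- by move=> v vr; rewrite ed nbr_sum_kids0.
- by move=> v vr; apply: sq; rewrite memd.
- by move=> v; rewrite D0 dead_sum_kids0.
Qed.

Lemma strip_halts s : base r s -> halts N strip s (fun s' => exists d, base r s' /\ stripped d s').
Proof.
move=> B; apply: halts_seq (strip_init_halts B) _ => {B}s I1.
apply: halts_seq (strip_edge_halts I1) _ => {I1}s I2.
apply: halts_seq (strip_root_halts I2) _ => {I2}s I3.
apply: halts_seq (strip_leaves_halts I3) _ => {I3}s /leaf_step_inv I4.
have [t [s' [e le_t /step_inv_stripped]]] := strip_step_halts I4.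
by exists t, s'.
Qed.


Lemma base_root x s : base r s -> base x (set_ivar s 2 (ix x)).
Proof.
move=> B; split; proj; [exact: (base_n B) | exact: (base_m B) | by []
  | exact: (base_src B) | exact: (base_dst B) | exact: (base_len B)].
Qed.

Lemma stripped_next d j s : stripped d s -> (j < #|V|.-1)%N ->
  let u := nth r d j in
  [/\ u != r, par u \notin take j.+1 d & take j.+1 d = rcons (take j d) u].
Proof.
move=> S jn u; split; last by rewrite (take_nth r) // (sd_size S).
  by rewrite -(sd_mem S) mem_nth // (sd_size S).
exact: sd_par S _ jn.
Qed.

Lemma stripped_par d k v s : stripped d s -> v != r -> v \notin take k d ->
  par v \notin take k d.
Proof.
move=> S vr; have vd : v \in d by rewrite (sd_mem S).
have id : (index v d < #|V|.-1)%N by rewrite -(sd_size S) index_mem.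
have := sd_par S id; rewrite nth_index // => pv.
rewrite in_take // -leqNgt => kv; apply: contra pv => pk.
by move: pk; rewrite -(take_takel d (leqW kv)) => /mem_take.
Qed.

Lemma stripped_eq d s s' : stripped d s -> iarr s' = iarr s ->
  rarr s' 1 = rarr s 1 -> rarr s' 2 = rarr s 2 -> stripped d s'.
Proof. by move=> [? ? ? ? ? ? ? ? ?] si s1 s2; split; rewrite ?si ?s1 ?s2. Qed.

(** * Values of all roots and the choice of the best one *)

Section RerootPass.
Variable F : V -> R.
Hypothesis F_root : F r = D r.
Hypothesis F_par : forall c, c != r -> F c =
  D c + branch (ell [set c; par c]%SET)
    (F (par c) - branch (ell [set c; par c]%SET) (D c)).

Record reroot_inv d k s : Prop := RerootInv {
  ri_base : base r s;
  ri_stripped : stripped d s;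
  ri_F : forall v, v \notin take (#|V|.-1 - k) d -> rarr s 3 (ix v) = F v;
  ri_best : exists b, [/\ ivar s 8 = ix b, b \notin take (#|V|.-1 - k) d
    & forall v, v \notin take (#|V|.-1 - k) d -> F b <= F v]
}.

Lemma reroot_start_halts d s : base r s -> stripped d s ->
  halts N (CRPut 3 (IVar 2) (RGet 1 (IVar 2));; CISet 8 (IVar 2);; CSkip) s
    (reroot_inv d 0).
Proof.
move=> B S; apply: halts_straight => //; do ! run_step (base_r B).
have rP v : v \notin take (#|V|.-1 - 0) d -> v = r.
  by rewrite subn0 -(sd_size S) take_size (sd_mem S) negbK => /eqP.
split; first keep_base B.
- by apply: (stripped_eq S); proj.
- by move=> v /rP->; proj; rewrite updE eqxx (sd_D S) F_root.
- exists r; split; first by proj.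
    by rewrite subn0 -(sd_size S) take_size (sd_mem S) eqxx.
  by move=> v /rP->.
Qed.

Lemma reroot_step_halts d s : reroot_inv d 0 s ->
  halts N (For (ISub (IVar 0) N1) reroot_step) s (reroot_inv d #|V|.-1).
Proof.
move=> S0; apply: halts_for => //; first by rewrite /N; lia.
- by move=> k {S0}s [B _ _ _] /=; rewrite (base_n B) subn1.
- case: S0 => B S Fv [b [b8 bd bm]]; split; first keep_base B.
  + by apply: (stripped_eq S); proj.
  + by proj.
  + by exists b; split=> //; proj.
move=> k {S0}s kn sk [B S Fv [b [b8 bd bm]]].
(* The stripped vertices occupy positions 0 to [#|V| - 2] of the queue, and round [k] treats the one
   at distance [k] from the last. *)
set j := (#|V| - 2 - k)%N; have jn : (j < #|V|.-1)%N by rewrite /j; lia.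
have jE : (#|V|.-1 - k = j.+1)%N by rewrite /j; lia.
have jE' : (#|V|.-1 - k.+1 = j)%N by rewrite /j; lia.
rewrite jE in Fv bd bm; have [] := stripped_next S jn.
set u := nth r d j => ur pu tk.
have s5 : iarr s 5 j = ix u by rewrite (sd_queue S).
rewrite /reroot_step /load_backwards /rbranch.
have updK T (f : nat -> T) i x : upd f i x i = x by rewrite updE eqxx.
have Fu := F_par ur; rewrite /branch !expr2 in Fu.
do ! run_step (base_n B, sk, s5, sd_nb S ur, sd_q S ur, sd_D S, Fv _ pu, b8, updK).
have ud : u \in take j.+1 d by rewrite tk mem_rcons mem_head.
have bu : b != u by apply: contraNneq bd => ->.
have split_u v : v \notin take j d -> v = u \/ v \notin take j.+1 d.
  by rewrite tk mem_rcons inE; case: eqP => [->|_]; [left | right].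
have utj : u \notin take j d.
  by have := take_uniq j.+1 (sd_uniq S); rewrite tk rcons_uniq => /andP[].
have F' v : v \notin take j d -> upd (rarr s 3) (ix u) (F u) (ix v) = F v.
  by rewrite updE ix_eq; case: eqP => [->|vu] // /split_u[/vu|/Fv].
rewrite -Fu updE ix_eq (negbTE bu) (Fv _ bd).
case: ltP => FuFb; do ! run_step sk.
  split; first keep_base B.
  - by apply: (stripped_eq S); proj.
  - by move=> v; rewrite jE'; proj; exact: F'.
  - exists u; rewrite jE'; split; [by proj | exact: utj |].
    by move=> v /split_u[->//|/bm]; apply: le_trans; exact: ltW.
split; first keep_base B.
- by apply: (stripped_eq S); proj.
- by move=> v; rewrite jE'; proj; exact: F'.
- exists b; rewrite jE'; split; first by proj.
    by apply: contra bd; rewrite tk mem_rcons inE => ->; rewrite orbT.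
  by move=> v /split_u[->//|/bm].
Qed.

Lemma reroot_best d s : reroot_inv d #|V|.-1 s ->
  exists b, [/\ forall v, F b <= F v, ivar s 8 = ix b & base r s].
Proof.
move=> [B S _ [b [b8 _ bm]]]; exists b; split=> // v.
by apply: bm; rewrite subnn take0.
Qed.
End RerootPass.

(** * Budgets from the root downwards *)

Section BudgetPass.

Definition local_budget s v :=
  rarr s 0 (jx v (par v)) = rarr s 3 (ix (par v)) *
    (Num.sqrt (ell [set v; par v]%SET) + Num.sqrt (D v)) *
    Num.sqrt (ell [set v; par v]%SET) / D (par v) /\
  rarr s 3 (ix v) = rarr s 3 (ix (par v)) *
    (Num.sqrt (ell [set v; par v]%SET) + Num.sqrt (D v)) *
    Num.sqrt (D v) / D (par v).

(** [base] cannot be maintained, because budgets overwrite the lengths. The square roots of the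
    lengths survive in real array 2, by [sd_q]. *)
Record budget_inv d k s : Prop := BudgetInv {
  bi_n : ivar s 0 = #|V|;
  bi_r : ivar s 2 = ix r;
  bi_stripped : stripped d s;
  bi_root : rarr s 3 (ix r) = 1;
  bi_local : forall v, v != r -> v \notin take (#|V|.-1 - k) d -> local_budget s v
}.

Lemma budget_start_halts d s : base r s -> stripped d s ->
  halts N (CRPut 3 (IVar 2) (RConst 1);; CSkip) s (budget_inv d 0).
Proof.
move=> B S; apply: halts_straight => //; do ! run_step (base_r B).
split; proj; [exact: (base_n B) | exact: (base_r B) | | by rewrite updE eqxx |].
  by apply: (stripped_eq S); proj.
by move=> v vr; rewrite subn0 -(sd_size S) take_size (sd_mem S) vr.
Qed.

(** Ensures that a budget, once written, is not overwritten by a later round. *)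
Lemma jx_inj u v : u != r -> v != r -> jx u (par u) = jx v (par v) -> u = v.
Proof.
move=> ur vr; rewrite /jx => uv; apply: (set2_par_inj rt ur vr).
have mem w : w != r -> [set w; par w]%SET \in map (@edge_of V) es.
  by move=> wr; rewrite mem_edges (par_edge rt).
by rewrite -(nth_index finset.set0 (mem u ur)) uv nth_index ?mem.
Qed.

Lemma budget_step_halts d s : budget_inv d 0 s ->
  halts N (For (ISub (IVar 0) N1) budget_step) s (budget_inv d #|V|.-1).
Proof.
move=> S0; apply: halts_for => //; first by rewrite /N; lia.
- by move=> k {S0}s [n0 _ _ _ _] /=; rewrite n0 subn1.
- case: S0 => n0 r0 S b0 bv; split; proj => //; first by apply: (stripped_eq S); proj.
move=> k {S0}s kn sk [n0 r0 S b0 bv].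
set j := (#|V| - 2 - k)%N; have jn : (j < #|V|.-1)%N by rewrite /j; lia.
have jE : (#|V|.-1 - k = j.+1)%N by rewrite /j; lia.
have jE' : (#|V|.-1 - k.+1 = j)%N by rewrite /j; lia.
rewrite jE in bv; have [] := stripped_next S jn.
set u := nth r d j => ur pu tk.
have s5 : iarr s 5 j = ix u by rewrite (sd_queue S).
have updK T (f : nat -> T) i x : upd f i x i = x by rewrite updE eqxx.
rewrite /budget_step /load_backwards /rbranch.
do ! run_step (n0, sk, s5, sd_nb S ur, sd_ed S ur, sd_q S ur, sd_D S, updK).
have ud : u \in take j.+1 d by rewrite tk mem_rcons mem_head.
split; proj => //; first by apply: (stripped_eq S); proj.
  by rewrite updE ix_eq eq_sym (negbTE ur).
move=> v vr; rewrite jE' => vd; rewrite /local_budget; proj.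
have [->|vu] := eqVneq v u.
  by rewrite !updE eqxx !ix_eq eqxx (negbTE (par_neq rt ur)).
have vd' : v \notin take j.+1 d by rewrite tk mem_rcons inE (negbTE vu).
(* [v] was settled before [u], hence so was its parent; writing the share of [u] leaves the
   equations at [v] intact. *)
have pvu : par v != u by apply: contraNneq (stripped_par S vr vd') => ->.
have jvu : (jx v (par v) == jx u (par u)) = false.
  by apply: contra_neqF vu => /eqP; exact: jx_inj.
by rewrite !updE !ix_eq (negbTE vu) (negbTE pvu) jvu; exact: bv.
Qed.
End BudgetPass.

End Machine.

Theorem theorem2 (R : realType) :
  exists (P : cmd) (K : nat),
    forall (V : finType) (E : {set {set V}}) (ell : {set V} -> R)
           (vs : seq V) (es : seq (V * V)),
      is_tree E ->
      (1 < #|V|)%N ->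
      (forall e : {set V}, e \in E -> 0 < ell e) ->
      lists_graph E vs es ->
      exists (B : {set V} -> R) (r : V) (t : nat) (s : state R),
        [/\ exec P (input_state ell vs es) t s,
            (t <= K * (#|V| + #|E|))%N,
            output_is s vs es B r,
            valid_allocation E B
          & wr E ell B r = BR E ell].
Proof.
(* [cost] is read off the program text, so the constant is independent of the tree. *)
exists optimal_allocation, (cost optimal_allocation).
move=> V E ell vs es T V1 ell_gt0 /andP[vs_perm es_perm].
have [_ E2 _ _] := T.
have /choice[rooted rootedP] : forall r, exists t : (V -> V) * (V -> nat) * (V -> R),
    rooting E r t.1.1 t.1.2 /\ tree_value ell r t.1.1 t.2.
  move=> r; have [par [h rt]] := tree_rooting r T.
  have [D DE] := tree_rec rt (fun c => branch (ell [set c; par c])).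
  by exists (par, h, D).
pose par r := (rooted r).1.1; pose h r := (rooted r).1.2; pose D r := (rooted r).2.
have rt r : rooting E r (par r) (h r) by have [] := rootedP r.
have DE r : tree_value ell r (par r) (D r) by have [] := rootedP r.
pose F v := D v v.
have [x0 _] := card_gt1P V1.
(* Index variable 2 is initially 0, so the first call of [strip] is rooted at the first listed
   vertex. *)
pose r0 := nth x0 vs 0; pose edges := map (@edge_of V) es.
have V_gt0 : (0 < size vs)%N by rewrite (size_vs vs_perm); lia.
have base0 : base E ell vs es r0 (input_state ell vs es).
  split=> //=.
  - exact: size_vs vs_perm.
  - by rewrite index_uniq // (vs_uniq vs_perm).
  - by move=> p0 k km; rewrite (nth_map p0).
  - by move=> p0 k km; rewrite (nth_map p0).
  - move=> u v; rewrite -(mem_edges es_perm) -/edges => uv.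
    have km : (index [set u; v] edges < size es)%N.
      by rewrite -(size_map (@edge_of V)) index_mem.
    rewrite (nth_map (u, v)) // -(nth_map _ finset.set0 (@edge_of V)) //.
    by rewrite nth_index.
(* The last command replaces the vertex count in index variable 0 by the answer, so the invariant is
   stated with the count put back. *)
suff [t [s [run_s t_le [r [d [rmin s0 [_ sr _ br bl]]]]]]] :
    halts (#|V| + #|E|)%N optimal_allocation (input_state ell vs es)
      (fun s => exists r d, [/\ forall v, F r <= F v, ivar s 0 = index r vs
        & budget_inv ell vs es r (par r) (D r) d #|V|.-1 (set_ivar s 0 #|V|)]).
  pose B e := rarr s 0 (index e edges); pose b v := rarr s 3 (index v vs).
  have loc c : c != r -> local_budget ell vs es (par r) (D r) s c.
    by move=> cr; apply: bl; rewrite // subnn take0.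
  have BE c (cr : c != r) := (loc c cr).1; have bE c (cr : c != r) := (loc c cr).2.
  have Bvalid : valid_allocation E B.
    exact: (budget_valid (b := b) E2 ell_gt0 (rt r) (DE r) br V1 BE bE).
  have wrF : (wr E ell B r <= (F r)%:E)%E.
    exact: (wr_upper_bound (B := B) (b := b) ell_gt0 (rt r) (DE r) br BE bE).
  exists B, r, t, s; split => //.
    split=> //; apply: (@eq_from_nth _ 0); rewrite size_mkseq ?size_map // => i im.
    rewrite nth_mkseq // (nth_map (x0, x0)) // /B.
    rewrite -(nth_map _ finset.set0 (@edge_of V)) // index_uniq ?size_map //.
    exact: edges_uniq es_perm.
  apply/eqP; rewrite eq_le; apply/andP; split; last first.
    apply: (le_trans (bigmin_le _ r _)); apply: ge_ereal_inf.
    by exists (wr E ell B r) => //; exists B.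
  (* For every root [v] and valid [B'], the chain is [wr E ell B r <= F r <= F v <= wr E ell B'
     v]. *)
  apply: (le_trans wrF); apply: le_bigmin => [|v _]; first exact: leey.
  apply/ereal_infP => _ [B' B'valid <-].
  apply: (@le_trans _ _ (F v)%:E); first by rewrite lee_fin.
  exact: (wr_lower_bound E2 ell_gt0 (rt v) (DE v) B'valid).
have N_gt0 : (0 < #|V| + #|E|)%N by lia.
rewrite /optimal_allocation.
apply: (halts_seq (strip_halts E2 V1 vs_perm es_perm (rt r0) (DE r0) base0)).
move=> {}s [d [B S]].
have F_par c : c != r0 -> F c = D r0 c + branch (ell [set c; par r0 c])
    (F (par r0 c) - branch (ell [set c; par r0 c]) (D r0 c)).
  by move=> cr; exact: reroot (rt r0) (rt c) (rt _) (DE r0) (DE c) (DE _) cr erefl.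
have start := reroot_start_halts V1 vs_perm es_perm (F := F) (D := D r0) erefl B S.
apply: (halts_seq start) => {start B S}s S.
apply: (halts_seq (reroot_step_halts V1 vs_perm es_perm F_par S)).
move=> {S}s /reroot_best[r [rmin s8 B]].
apply: (halts_seq (Q1 := base E ell vs es r)).
  apply: halts_straight => //; do ! run_step s8; exact: base_root B.
move=> {B s8}s B.
apply: (halts_seq (strip_halts E2 V1 vs_perm es_perm (rt r) (DE r) B)).
move=> {B d}s [d [B S]].
apply: (halts_seq (budget_start_halts V1 vs_perm es_perm B S)) => {B S}s S.
apply: (halts_seq (budget_step_halts V1 vs_perm es_perm (rt r) S)).
move=> {S}s S; apply: halts_straight => //; do ! run_step (bi_r S).
exists r, d; split=> //.
case: S => _ sr St br bl; split; proj => //.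
by apply: (stripped_eq St); proj.
Qed.
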